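(* Assume that $\lambda\in C^1(0,T;M)$, that $\{\xi_h\}_{h>0}$, $\{\alpha_h\}_{h>0}$, $\{\beta_h\}_{h>0}$ are bounded uniformly in $h$, in the sense that $\sup_{h>0}\xi_h<\infty$, $\inf_{h>0}\alpha_h>0$, $\inf_{h>0}\beta_h>0$, and that $u\in H^1(0,T;X)\cap H^2(0,T;Y)$. Then, provided $\Delta t$ is small enough, there exists a constant $C>0$ independent of $h$ and $\Delta t$ such that $$\begin{aligned}\max_{1\le n\le N}&\langle R(u(t_n)-u_h^n),u(t_n)-u_h^n\rangle_Y+\Delta t\sum_{n=1}^N\|u(t_n)-u_h^n\|_X^2\\&\le C\Big\{\|u_0-u_{0,h}\|_Y^2+\max_{0\le n\le N}\Big(\inf_{z\in X_h}\|u(t_n)-z\|_X\Big)^2+\int_0^T\Big(\inf_{z\in X_h}\|\partial_tu(t)-z\|_X\Big)^2dt\\&\qquad+(\Delta t)^2\|\partial_{tt}u\|_{L^2(0,T;Y)}^2+\Delta t\sum_{n=1}^N\Big(\inf_{\mu\in M_h}\|\partial_t\lambda(t_n)-\mu\|_M\Big)^2\Big\}.\end{aligned}$$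
   Context: $X$ and $Y$ are real Hilbert spaces, $X\subseteq Y$ with continuous and dense imbedding; $M$ is a real reflexive Banach space. $R:Y\to Y'$ and $A:X\to X'$ are bounded linear operators, $b:X\times M\to\mathbb{R}$ is a bounded bilinear form; $\langle\cdot,\cdot\rangle_Z$ denotes the duality pairing between $Z'$ and $Z$. $V:=\{v\in X: b(v,\mu)=0\ \forall\mu\in M\}$ and $W$ is the closure of $V$ in the $Y$-norm. Standing assumptions: there is $\beta>0$ with $\sup_{0\ne v\in X}b(v,\mu)/\|v\|_X\ge\beta\|\mu\|_M$ for all $\mu\in M$; $R$ is self-adjoint and monotone on $V$ ($\langle Rv,w\rangle_Y=\langle Rw,v\rangle_Y$ and $\langle Rv,v\rangle_Y\ge0$ for all $v,w\in V$); $A$ is self-adjoint on $V$ ($\langle Av,w\rangle_X=\langle Aw,v\rangle_X$ for all $v,w\in V$); there are $\gamma,\alpha>0$ with $\langle Av,v\rangle_X+\gamma\langle Rv,v\rangle_Y\ge\alpha\|v\|_X^2$ for all $v\in V$; $u_0\in W$; $g\in H^1(0,T;M')$; $f\in L^2(0,T;X')$, which enters the discrete problem through the values $f(t_n)$. Continuous problem: $u\in L^2(0,T;X)$ and $\lambda\in H^1(0,T;M)$, with $\lambda(0)=0$, satisfy $$\frac{d}{dt}[\langle Ru(t),v\rangle_Y+b(v,\lambda(t))]+\langle Au(t),v\rangle_X=\langle f(t),v\rangle_X\quad\forall v\in X\ \text{in }\mathcal{D}'(0,T),$$ $$b(u(t),\mu)=\langle g(t),\mu\rangle_M\ \ \forall\mu\in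 M,\qquad\langle Ru(0),v\rangle_Y=\langle Ru_0,v\rangle_Y\ \ \forall v\in Y.$$ Discretization: $\{X_h\}_{h>0}$, $\{M_h\}_{h>0}$ are families of finite-dimensional subspaces of $X$, $M$; $t_n:=n\Delta t$, $n=0,\dots,N$, $\Delta t:=T/N$; $\bar\partial\theta^n:=(\theta^n-\theta^{n-1})/\Delta t$; $V_h:=\{v\in X_h:b(v,\mu)=0\ \forall\mu\in M_h\}$. It is assumed that for each $h$ there are $\xi_h,\alpha_h>0$ with $\langle Av,v\rangle_X+\xi_h\langle Rv,v\rangle_Y\ge\alpha_h\|v\|_X^2$ for all $v\in V_h$, and $\beta_h>0$ with $\sup_{0\neq v\in X_h}b(v,q)/\|v\|_X\ge\beta_h\|q\|_M$ for all $q\in M_h$. Fully-discrete problem: given an approximation $u_{0,h}\in X_h$ of $u_0$, set $u_h^0:=u_{0,h}$, $\lambda_h^0:=0$; $(u_h^n,\lambda_h^n)\in X_h\times M_h$, $n=1,\dots,N$, satisfies $$\langle R\bar\partial u_h^n,v\rangle_Y+b(v,\bar\partial\lambda_h^n)+\langle Au_h^n,v\rangle_X=\langle f(t_n),v\rangle_X\ \ \forall v\in X_h,\qquad b(u_h^n,\mu)=\langle g(t_n),\mu\rangle_M\ \ \forall\mu\in M_h.$$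
   Formalization: R is assumed self-adjoint and monotone on all of X, not only on V (the estimate fails otherwise, since V_h need not lie in V); f, g and u are taken as their continuous representatives on [0,T], and C^1(0,T;M) is read as C^1([0,T];M). *)

(* Defs.v *)
From HB Require Import structures.
From mathcomp Require Import all_boot all_order all_algebra.
From mathcomp Require Import sesquilinear.
From mathcomp Require Import all_classical all_reals all_analysis.

Set Implicit Arguments.
Unset Strict Implicit.
Unset Printing Implicit Defensive.

Import Order.TTheory GRing.Theory Num.Theory.
Import numFieldNormedType.Exports.

Local Open Scope classical_set_scope.
Local Open Scope ring_scope.

Definition hilbertian (R : realType) (X : completeNormedModType R) : Prop :=
  exists ip : {dot X for idfun}, forall x : X, ip x x = `|x| ^+ 2.

Section dual_space.
Context {R : realType} (E : normedModType R).

Definition dual_pred : {pred E -> R^o} :=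
  fun l => `[< linear l /\ continuous l >].

Record dual := Dual { dual_fun :> E -> R^o ; _ : dual_fun \in dual_pred }.

HB.instance Definition _ := [isSub for dual_fun].
HB.instance Definition _ := [Choice of dual by <:].

Lemma dual_pred_submod_closed : submod_closed dual_pred.
Proof.
split.
  apply/asboolP; split; last exact: cst_continuous.
  by move=> a x y; rewrite [RHS]addr0 [RHS]mulr0.
move=> a f g /asboolP[lf cf] /asboolP[lg cg].
apply/asboolP; split => [c x y|x].
  rewrite -[LHS]/(a *: f (c *: x + y) + g (c *: x + y)) lf lg.
  rewrite -[RHS]/(c *: (a *: f x + g x) + (a *: f y + g y)).
  by rewrite !scalerDr !scalerA (mulrC a c) addrACA.
by apply: cvgD; [apply: cvgZr; exact: cf|exact: cg].
Qed.

HB.instance Definition _ :=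
  GRing.isSubmodClosed.Build R (E -> R^o) dual_pred dual_pred_submod_closed.
HB.instance Definition _ := [SubChoice_isSubLmodule of dual by <:].

Definition dual_norm (l : dual) : R :=
  sup [set `|l x| | x in [set x : E | `|x| <= 1]].

Lemma dual_bounded (l : dual) :
  exists2 C : R, 0 <= C & forall x, `|l x| <= C * `|x|.
Proof.
case: l => l /asboolP[ll cl] /=.
pose L := GRing.isLinear.Build R E R^o *:%R l ll.
pose f : {linear E -> R^o} := HB.pack l L.
have /linear_boundedP : bounded_near f (nbhs (0 : E)).
  exact/linear_bounded_continuous.
by move=> /pinfty_ex_gt0[C C0 fC]; exists C => //; exact: ltW.
Qed.

Let ball_set (l : dual) := [set `|l x| | x in [set x : E | `|x| <= 1]].

Let has_sup_ball (l : dual) : has_sup (ball_set l).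
Proof.
split; first by exists `|l 0|; exists 0 => //=; rewrite normr0.
have [C C0 lC] := dual_bounded l; exists C => _ [x /= x1 <-].
by rewrite (le_trans (lC x))// ler_piMr.
Qed.

Lemma dualZ (l : dual) (a : R) (x : E) : l (a *: x) = a * l x.
Proof.
case: l => l /asboolP[ll _] /=.
have l0 : l 0 = 0 by have := ll (-1) 0 0; rewrite scaler0 addr0 scaleN1r addNr.
by have := ll a x 0; rewrite l0 !addr0.
Qed.

Lemma dual_norm_ge0 (l : dual) : 0 <= dual_norm l.
Proof.
apply: (le_trans (normr_ge0 (l 0))); apply: (sup_upper_bound (has_sup_ball l)).
by exists 0 => //=; rewrite normr0.
Qed.

Lemma le_dual_norm (l : dual) (x : E) : `|l x| <= dual_norm l * `|x|.
Proof.
have [->|x0] := eqVneq x 0.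
  by rewrite -(scale0r 0) dualZ mul0r !normr0 mulr_ge0// dual_norm_ge0.
have nx : 0 < `|x| by rewrite normr_gt0.
rewrite -ler_pdivrMr//; apply: (sup_upper_bound (has_sup_ball l)).
exists (`|x|^-1 *: x) => /=.
  by rewrite normrZ ger0_norm ?invr_ge0// mulVf ?gt_eqF.
by rewrite dualZ normrM ger0_norm ?invr_ge0// mulrC.
Qed.

Lemma dual_norm_le (l : dual) (C : R) :
  (forall x, `|x| <= 1 -> `|l x| <= C) -> dual_norm l <= C.
Proof.
move=> lC; apply: ge_sup; first by case: (has_sup_ball l).
by move=> _ [x /= x1 <-]; exact: lC.
Qed.

Lemma dual_normD (l m : dual) : dual_norm (l + m) <= dual_norm l + dual_norm m.
Proof.
apply: dual_norm_le => x x1; rewrite (le_trans (ler_normD _ _))//.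
by apply: lerD; rewrite (le_trans (le_dual_norm _ _))// ler_piMr ?dual_norm_ge0.
Qed.

Lemma dual_normZ (a : R) (l : dual) : dual_norm (a *: l) = `|a| * dual_norm l.
Proof.
have H (c : R) (m : dual) : dual_norm (c *: m) <= `|c| * dual_norm m.
  apply: dual_norm_le => x x1.
  have -> : (c *: m) x = c * m x by [].
  rewrite normrM ler_wpM2l// (le_trans (le_dual_norm _ _))//.
  by rewrite ler_piMr ?dual_norm_ge0.
apply/eqP; rewrite eq_le H /=.
have [->|a0] := eqVneq a 0; first by rewrite normr0 mul0r dual_norm_ge0.
rewrite -ler_pdivlMl ?normr_gt0// -{1}(scalerK a0 l).
by rewrite (le_trans (H _ _))// normfV.
Qed.

Lemma dual_norm0_eq0 (l : dual) : dual_norm l = 0 -> l = 0.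
Proof.
move=> l0; apply: val_inj; apply/funext => x /=; apply/eqP.
by rewrite -normr_le0 (le_trans (le_dual_norm _ _))// l0 mul0r.
Qed.

HB.instance Definition _ :=
  Lmodule_isNormed.Build R dual dual_normD dual_normZ dual_norm0_eq0.

End dual_space.

Arguments dual {R} E.

Definition reflexive_space (R : realType) (M : completeNormedModType R) : Prop :=
  forall phi : dual (dual M), exists m : M, forall l : dual M, phi l = l m.

Section subspaces.
Context {R : realType}.

Definition finite_dim_subspace (E : normedModType R) (S : set E) : Prop :=
  exists (n : nat) (e : 'I_n -> E),
    S = [set \sum_(i < n) c i *: e i | c in [set: 'I_n -> R]].

Definition dist_to (E : normedModType R) (S : set E) (x : E) : R :=
  inf [set `|x - z| | z in S].

(* {v in S | b(v, mu) = 0 for all mu in Q} *)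
Definition annihilated (X M : normedModType R) (b : X -> M -> R)
    (S : set X) (Q : set M) : set X :=
  [set v | S v /\ forall m, Q m -> b v m = 0].

Definition inf_sup (X M : normedModType R) (b : X -> M -> R)
    (S : set X) (Q : set M) (beta : R) : Prop :=
  forall m, Q m ->
    beta * `|m| <= sup [set b v m / `|v| | v in [set v | S v /\ v != 0]].

End subspaces.

Section bochner.
Context {R : realType} {E : normedModType R}.
Notation mu := (@lebesgue_measure R).
Implicit Types (D : set R) (f u s : R -> E).

Definition simple_function s : Prop :=
  finite_set (range s) /\ forall x, measurable (s @^-1` [set x]).

Definition strongly_measurable D f : Prop :=
  exists s : nat -> R -> E, (forall n, simple_function (s n)) /\
    {ae mu, forall t, D t -> s ^~ t @ \oo --> f t}.

(* only used for D of finite measure *)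
Definition simple_integral D s : E :=
  \sum_(x \in range s) fine (mu (D `&` s @^-1` [set x])) *: x.

Definition is_bochner_integral D f (I : E) : Prop :=
  strongly_measurable D f /\
  exists s : nat -> R -> E, [/\ forall n, simple_function (s n),
    (fun n => \int[mu]_(t in D) `|f t - s n t|%:E)%E @ \oo --> 0%E &
    (fun n => simple_integral D (s n)) @ \oo --> I].

Definition L2norm_sq (T : R) f : \bar R :=
  (\int[mu]_(t in `]0%R, T[) (`|f t| ^+ 2)%:E)%E.

Definition in_L2 (T : R) f : Prop :=
  strongly_measurable `]0, T[ f /\ (L2norm_sq T f < +oo)%E.

Definition test_function (T : R) (phi : R -> R) : Prop :=
  (forall n t, derivable (derive1n n phi) t 1) /\
  exists a b, [/\ 0 < a, b < T & forall t, t \notin `[a, b] -> phi t = 0].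

Definition weak_derivative (T : R) u (du : R -> E) : Prop :=
  forall phi, test_function T phi -> exists I : E,
    is_bochner_integral `]0, T[ (fun t => derive1 phi t *: u t) I /\
    is_bochner_integral `]0, T[ (fun t => phi t *: du t) (- I).

(* u in H^1(0,T;E) with weak derivative du *)
Definition in_H1 (T : R) u (du : R -> E) : Prop :=
  [/\ in_L2 T u, in_L2 T du & weak_derivative T u du].

(* u in H^2(0,T;E) with second weak derivative ddu *)
Definition in_H2 (T : R) u (ddu : R -> E) : Prop :=
  exists du, in_H1 T u du /\ in_H1 T du ddu.

(* u in C^1([0,T];E) with derivative du, extended by continuity to 0 and T *)
Definition in_C1 (T : R) u (du : R -> E) : Prop :=
  [/\ {within `[0, T], continuous u}, {within `[0, T], continuous du} &
      forall t, t \in `]0, T[ -> is_derive t 1 u (du t)].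

End bochner.

(* (d/dt) F + a = c in D'(0,T) *)
Definition distributional_ode (R : realType) (T : R) (F a c : R -> R) : Prop :=
  forall phi, test_function T phi ->
    - (\int[lebesgue_measure]_(t in `]0, T[) (F t * derive1 phi t))
    + \int[lebesgue_measure]_(t in `]0, T[) (a t * phi t)
    = \int[lebesgue_measure]_(t in `]0, T[) (c t * phi t).

Section problems.
Context {R : realType} {X Y M : completeNormedModType R}.
(* [j] is the imbedding of X into Y *)
Variables (j : X -> Y) (Rop : Y -> dual Y) (Aop : X -> dual X).
Variable b : X -> M -> R.

Definition continuous_problem (T : R) (f : R -> dual X) (g : R -> dual M)
    (u0 : Y) (u : R -> X) (lam : R -> M) : Prop :=
  [/\ forall v : X, distributional_ode T
        (fun t => Rop (j (u t)) (j v) + b v (lam t))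
        (fun t => Aop (u t) v) (fun t => f t v),
      {ae lebesgue_measure, forall t, t \in `]0, T[ ->
        forall m : M, b (u t) m = g t m},
      forall v : Y, Rop (j (u 0)) v = Rop u0 v &
      lam 0 = 0].

Definition backward_diff (E : lmodType R) (dt : R) (th : nat -> E) (n : nat) : E :=
  dt^-1 *: (th n - th n.-1).

Definition discrete_problem (dt : R) (N : nat) (f : R -> dual X)
    (g : R -> dual M) (Xh : set X) (Mh : set M) (u0h : X)
    (uh : nat -> X) (lamh : nat -> M) : Prop :=
  [/\ uh 0 = u0h, lamh 0 = 0 &
    forall n, (1 <= n <= N)%N ->
    [/\ Xh (uh n), Mh (lamh n),
      forall v, Xh v ->
        Rop (j (backward_diff dt uh n)) (j v) + b v (backward_diff dt lamh n)
        + Aop (uh n) v = f (n%:R * dt) v &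
      forall m, Mh m -> b (uh n) m = g (n%:R * dt) m]].

End problems.

(* Symmetry and monotonicity of R on all of X (equivalently, by density, on Y).
   Asking for them only on V = {v in X | b(v, .) = 0} is not enough for the
   error estimate, because V_h is in general not contained in V.  Counterexample:
   X = Y = RR^2, M = RR, b(v, m) = v_1 m, R = diag(-1, 1), A = id,
   u0 = f = g = u = lam = 0, M_h = {0} and X_h = span v_h with
   v_h = (cos th, sin th), <R v_h, v_h> = - r_h where 0 < r_h <= 1 and r_h -> 0,
   xi_h = alpha_h = 1/2, beta_h = 1, u0h = v_h.  Then
   u_h^n = (1 - dt / r_h)^-n v_h, which for dt = r_h / 2 has size 2^n = 4^(T/r_h)
   at n = N (T / dt = 2 T / r_h integral), while the right-hand side is C. *)
Definition R_sign_condition (R : realType) (X Y : completeNormedModType R)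
    (j : X -> Y) (Rop : Y -> dual Y) : Prop :=
  forall v w : X, Rop (j v) (j w) = Rop (j w) (j v) /\ 0 <= Rop (j v) (j v).

(* Main.v *)
Require Import Defs.
From HB Require Import structures.
From mathcomp Require Import all_boot all_order all_algebra.
From mathcomp Require Import finmap sesquilinear.
From mathcomp Require Import all_classical all_reals all_analysis.
From mathcomp Require Import measurable_realfun.
From mathcomp Require Import ring lra.

Set Implicit Arguments.
Unset Strict Implicit.
Unset Printing Implicit Defensive.

Import Order.TTheory GRing.Theory Num.Theory.
Import numFieldNormedType.Exports.

Local Open Scope classical_set_scope.
Local Open Scope ring_scope.

(** Write the error at [t_n] as [eta n + theta n] with [eta = u - P u] and
    [theta = P u - u_h], where [P] is a Fortin projection onto [X_h]: linear,
    with [b (v - P v) m = 0] for [m] in [M_h], and with [v - P v] bounded by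
    the distance from [v] to [X_h] times a constant depending only on the bound
    of [b] and on the discrete inf-sup constant ([fortin_operator]).  The part
    [eta] is thus controlled by the best approximation error.

    For [n >= 1] the vector [theta n] lies in [V_h], because [u] and [u_h]
    satisfy the same constraint at [t_n] against [M_h].  Testing the difference
    of the two equations with [theta n] therefore removes the discrete
    multiplier and leaves [b (theta n) (d_t lambda (t_n))], which is bounded
    through the distance from [d_t lambda (t_n)] to [M_h].  Polarization
    bounds the discrete time derivative of the energy
    [r n = <R theta n, theta n>] from above, and the Garding inequality on [V_h]
    makes the form of [A] coercive at the price of [xi r n]
    ([scheme_energy_step]).  The outcome is a recursion

      [r n - r n.-1 + dt al |theta n|^2 <= 2 xi dt r n + dt (B n)^2 / al]

    with [B n] made of consistency and approximation errors; a discrete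
    Gronwall inequality, valid once [4 xi dt <= 1], then gives the estimate
    ([discrete_gronwall], [error_bound_of_step]).

    The equation for [u] holds only in the sense of distributions, so both
    time-dependent errors are extracted from scalar pairings.  For fixed [v],
    integrating the term in [lambda] by parts shows that [<R u(t), v>] has the
    continuous weak derivative [Phi t = <f, v> - <A u, v> - b v (d_t lambda)];
    testing with derivatives of test functions shows that [Phi] in turn has the
    weak derivative [<R d_tt u, v>] ([solution_consistency]).  The fundamental
    theorem of calculus for weak derivatives ([weak_ftc]), used twice, bounds
    the backward Euler consistency error by
    [dt |R| |v|] times the integral of [|d_tt u|] over the step; used once on a
    functional adapted to the increment of [eta], it bounds this increment by
    the integral of the distance from [d_t u] to [X_h] ([projection_increment]).

    Bochner integrals meet Lebesgue integrals through the pairing with a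
    functional ([bochner_integral_dual]).  The norm of a strongly measurable
    function need not be Borel, and its integral is then a lower integral; each
    such function is replaced off a null set by a Borel representative, which
    does not increase the integrals of the right-hand side
    ([strongly_measurable_representative], [null_le_lower_integral]).

    The initial condition determines only [R u(0)], not [u(0)].  By density
    [R] is symmetric on all of [Y] ([symmetric_of_dense]), so [u(0) - u0], being
    in the kernel of [R], contributes nothing to the initial energy
    ([initial_energy_le]). *)

(** * Lower integrals and Bochner integrals *)

Section lower_integral.
Context d (T : measurableType d) (R : realType).
Variable mu : {measure set T -> \bar R}.
Local Open Scope ereal_scope.

(** The integral of a nonnegative function is a supremum over the simple
    functions below it, hence monotone even where measurability fails. *)
Lemma le_lower_integral (D : set T) (f g : T -> \bar R) :
  (forall x, D x -> 0 <= f x) -> (forall x, D x -> f x <= g x) ->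
  \int[mu]_(x in D) f x <= \int[mu]_(x in D) g x.
Proof.
move=> f0 fg.
have fgD x : (f \_ D) x <= (g \_ D) x.
  by rewrite !patchE; case: ifPn => // /set_mem Dx; exact: fg.
rewrite integral_mkcond [leRHS]integral_mkcond !ge0_integralTE.
- by apply: ereal_sup_le => _ [h hf <-]; exists h => // x; rewrite (le_trans (hf x)).
- by move=> x; apply: erestrict_ge0 => y Dy; rewrite (le_trans (f0 _ Dy) (fg _ Dy)).
- by move=> x; exact: erestrict_ge0.
Qed.

(** A null set can be discarded only on the side of the measurable function
    [f]; what remains is an inequality between lower integrals.  Thus an upper
    bound of [f] almost everywhere by an arbitrary [g] can be integrated. *)
Lemma null_le_lower_integral (D N : set T) (f g : T -> \bar R) :
  measurable D -> measurable N -> mu N = 0 -> measurable_fun D f ->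
  (forall x, D x -> 0 <= f x) -> (forall x, D x -> 0 <= g x) ->
  (forall x, D x -> ~ N x -> f x <= g x) ->
  \int[mu]_(x in D) f x <= \int[mu]_(x in D) g x.
Proof.
move=> mD mN N0 mf f0 g0 fg.
rewrite (ge0_negligible_integral mN)// integral_mkcond.
rewrite [leRHS]integral_mkcond.
apply: le_lower_integral => x _.
  by apply: erestrict_ge0 => y [Dy _]; exact: f0.
rewrite !patchE; case: ifPn => [/set_mem[Dx Nx]|_]; first by rewrite mem_set//= fg.
by case: ifPn => [/set_mem Dx|//]; exact: g0.
Qed.

End lower_integral.

Section bochner_to_scalar.
Context {R : realType} {E : normedModType R}.
Notation mu := (@lebesgue_measure R).

(** A simple function has finitely many level sets, all measurable, so its
    composition with any map whatsoever is a finite sum of indicators. *)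
Lemma simple_function_comp_measurable (s : R -> E) (g : E -> R) D :
  simple_function s -> measurable D -> measurable_fun D (g \o s).
Proof.
move=> [fins ms] mD.
have -> : g \o s = (fun t => \sum_(x <- fset_set (range s)) g x * \1_(s @^-1` [set x]) t).
  apply/funext => t /=.
  rewrite (bigD1_seq (s t))/= ?fset_uniq//; last by rewrite in_fset_set// mem_set.
  rewrite indicE mem_set//= mulr1 big1 ?addr0// => x xs.
  by rewrite indicE memNset ?mulr0//= => /esym/eqP; rewrite (negbTE xs).
by apply: measurable_sum => x; exact: measurable_funM.
Qed.

(** Off a null set [f] is the limit of simple functions.  Setting it to [0] on
    that set gives a function whose composition with a continuous real map is a
    pointwise limit of measurable real functions. *)
Lemma strongly_measurable_representative (D : set R) (f : R -> E) :
  measurable D -> strongly_measurable D f ->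
  exists (f' : R -> E) (N : set R), [/\ measurable N, mu N = 0%E,
    forall t, D t -> ~ N t -> f' t = f t &
    forall g : E -> R, continuous g -> measurable_fun D (g \o f')].
Proof.
move=> mD [s [ss [N [mN N0 sN]]]].
pose f' t := if t \in N then 0 else f t.
exists f', N; split => // [t Dt Nt|g cg]; first by rewrite /f' memNset.
rewrite -(setDUK (@subIsetl _ D N)).
apply/measurable_funU; [exact: measurableI|by apply: measurableD => //; exact: measurableI|split].
  apply: (@eq_measurable_fun _ _ _ _ _ (cst (g 0))) => // t /set_mem[Dt Nt].
  by rewrite /= /f' mem_set.
apply: (@measurable_fun_cvg _ _ _ _ (fun n => g \o s n)) => [n|t [Dt DN]].
  by apply: simple_function_comp_measurable => //; apply: measurableD => //; exact: measurableI.
have Nt : ~ N t by move=> Nt; apply: DN; split.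
rewrite /= (_ : f' t = f t); last by rewrite /f' memNset.
apply: continuous_cvg; first exact: cg.
by apply: contrapT => H; apply: Nt; apply: sN => /= /(_ Dt).
Qed.

Lemma dual_is_linear (l : dual E) : linear l.
Proof. by have /asboolP[] := valP l. Qed.

Lemma dual_is_continuous (l : dual E) : continuous l.
Proof. by have /asboolP[] := valP l. Qed.

Lemma dualD (l : dual E) x y : l (x + y) = l x + l y.
Proof. by have := dual_is_linear l 1 x y; rewrite !scale1r. Qed.

Lemma dualN (l : dual E) x : l (- x) = - l x.
Proof. by rewrite -scaleN1r dualZ mulN1r. Qed.

Lemma dualB (l : dual E) x y : l (x - y) = l x - l y.
Proof. by rewrite dualD dualN. Qed.

Lemma dual_map0 (l : dual E) : l 0 = 0.
Proof. by rewrite -(scale0r 0) dualZ mul0r. Qed.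

Lemma dual_map_sum (l : dual E) (I : Type) (r : seq I) (F : I -> E) :
  l (\sum_(i <- r) F i) = \sum_(i <- r) l (F i).
Proof. exact: (big_morph _ (dualD l) (dual_map0 l)). Qed.

Lemma integral_simple_function_comp (D : set R) (s : R -> E) (g : E -> R) :
  measurable D -> (mu D < +oo)%E -> simple_function s ->
  mu.-integrable D (EFin \o (g \o s)) /\
  \int[mu]_(t in D) g (s t) =
    \sum_(x <- fset_set (range s)) g x * fine (mu (D `&` s @^-1` [set x])).
Proof.
move=> mD Doo ss; have [fins ms] := ss.
have gsE : EFin \o (g \o s) = (fun t => \sum_(x <- fset_set (range s))
    (g x)%:E * (\1_(s @^-1` [set x]) t)%:E)%E.
  apply/funext => t /=.
  rewrite (bigD1_seq (s t))/= ?fset_uniq//; last by rewrite in_fset_set// mem_set.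
  rewrite indicE mem_set//= mule1 big1 ?adde0// => x xs.
  by rewrite indicE memNset ?mule0//= => /esym/eqP; rewrite (negbTE xs).
have i1 x : mu.-integrable D (EFin \o (\1_(s @^-1` [set x]) : R -> R)).
  apply/integrableP; split.
    apply/measurable_EFinP; apply: measurable_funTS; exact: measurable_indic (ms x).
  under eq_integral do rewrite /= ger0_norm//.
  rewrite integral_indic//; last exact: ms.
  apply: le_lt_trans Doo.
  apply: le_measure; [|exact: mem_set|exact: subIsetr].
  by apply: mem_set; exact: measurableI (ms x) mD.
have i2 x : mu.-integrable D (fun t => (g x)%:E * (\1_(s @^-1` [set x]) t)%:E)%E.
  exact: (@integrableZl _ _ R mu D mD (g x) _ (i1 x)).
split; first by rewrite gsE; apply: integrable_sum => // x _; exact: i2.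
rewrite /Rintegral.
have -> : (fun t => (g (s t))%:E) = (fun t => \sum_(x <- fset_set (range s))
    (g x)%:E * (\1_(s @^-1` [set x]) t)%:E)%E by rewrite -gsE.
rewrite integral_sum//.
rewrite (eq_bigr (fun x => (g x * fine (mu (D `&` s @^-1` [set x])))%:E)).
  by rewrite sumEFin.
move=> x _; rewrite integralZl//; last exact: i1.
rewrite integral_indic//; last exact: ms.
rewrite EFinM setIC fineK// ge0_fin_numE//; apply: le_lt_trans Doo.
apply: le_measure; [|exact: mem_set|exact: subIsetl].
by apply: mem_set; exact: measurableI mD (ms x).
Qed.

Lemma dual_simple_integral (D : set R) (s : R -> E) (l : dual E) :
  measurable D -> (mu D < +oo)%E -> simple_function s ->
  \int[mu]_(t in D) l (s t) = l (simple_integral D s).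
Proof.
move=> mD Doo ss; rewrite (integral_simple_function_comp l mD Doo ss).2.
rewrite /simple_integral fsbig_finite; last by case: ss.
by rewrite dual_map_sum; apply: eq_bigr => x _; rewrite dualZ mulrC.
Qed.

(** Simple functions satisfy the identity by linearity of [l], and
    [G - l s_n] is dominated by the norm of [F - s_n] times the bound of [l]: the
    convergence of the Bochner integrals carries over to the scalar ones.  The
    measurable [G] stands for [l F], which may fail to be Borel. *)
Lemma bochner_integral_dual (D N : set R) (F : R -> E) (I : E) (l : dual E) (G : R -> R) :
  measurable D -> (mu D < +oo)%E -> measurable N -> mu N = 0%E ->
  measurable_fun D G -> (forall t, D t -> ~ N t -> G t = l (F t)) ->
  is_bochner_integral D F I ->
  mu.-integrable D (EFin \o G) /\ \int[mu]_(t in D) G t = l I.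
Proof.
move=> mD Doo mN N0 mG GE [_ [s [ss sF sI]]].
have [C0 C00 lC0] := dual_bounded l.
(* a strictly positive bound of [l], so that dividing by it is possible *)
pose C := C0 + 1; have C_gt0 : 0 < C by rewrite /C ltr_wpDl.
have lC x : `|l x| <= C * `|x|.
  by rewrite (le_trans (lC0 x))// ler_wpM2r// /C lerDl.
pose d n t := G t - l (s n t).
have ils n := (integral_simple_function_comp l mD Doo (ss n)).1.
have md n : measurable_fun D (d n).
  have ml := simple_function_comp_measurable (l : E -> R) (ss n) mD.
  exact: (measurable_funB mG ml).
have mnd n : measurable_fun D (fun t => `|d n t|%:E).
  by apply/measurable_EFinP; exact: measurableT_comp.
have dle n : (\int[mu]_(t in D) `|d n t|%:E <=
     C%:E * \int[mu]_(t in D) `|F t - s n t|%:E)%E.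
  rewrite muleC -lee_pdivrMr//.
  rewrite muleC -ge0_integralZl//; [|exact: mnd|by rewrite lee_fin invr_ge0 ltW].
  apply: (@null_le_lower_integral _ _ R mu D N _ (fun t => `|F t - s n t|%:E) mD mN N0).
  - by apply: emeasurable_funM; [exact: measurable_cst|exact: mnd].
  - by move=> t Dt; rewrite mule_ge0// lee_fin invr_ge0 ltW.
  - by move=> t Dt; rewrite lee_fin.
  move=> t Dt Nt; rewrite -EFinM lee_fin ler_pdivrMl// /d GE// -dualB.
  exact: lC.
have /fine_cvgP[finF cvgF] := sF.
have id : \forall n \near \oo, mu.-integrable D (EFin \o d n).
  move: finF; apply: filterS => m finm.
  apply/integrableP; split; first by apply/measurable_EFinP; exact: md.
  by rewrite (le_lt_trans (dle m))// ltey_eq fin_numM.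
have iG : mu.-integrable D (EFin \o G).
  have [n _ /(_ n)/= /(_ (leqnn n)) idn] := id.
  have -> : EFin \o G = (EFin \o d n) \+ (EFin \o (l \o s n)).
    by apply/funext => t /=; rewrite -EFinD /d subrK.
  exact: integrableD.
split=> //.
pose lI n : R := l (simple_integral D (s n)).
have cvgl : lI @ \oo --> (l I : R).
  exact: (cvg_comp _ _ sI (@dual_is_continuous l I)).
suff cvgG : lI @ \oo --> \int[mu]_(t in D) G t.
  by rewrite -(cvg_lim _ cvgG)// -(cvg_lim _ cvgl).
apply/cvgrPdist_le => /= e e0.
have ec : 0 < e / C by rewrite divr_gt0.
move/cvgrPdist_le : cvgF => /(_ _ ec) cF.
apply: filterS3 id finF cF => m idn finn; rewrite sub0r normrN => cFn.
rewrite /lI -(dual_simple_integral l mD Doo (ss m)) -RintegralB//; last exact: ils.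
rewrite (le_trans (le_normr_Rintegral _ _))//.
rewrite -lee_fin /Rintegral fineK; last first.
  by apply: integrable_fin_num => //; exact: integrable_norm idn.
apply: (le_trans (dle m)); rewrite -lee_pdivlMl// -(fineK finn) lee_fin mulrC.
by rewrite (le_trans (ler_norm _)).
Qed.

End bochner_to_scalar.

(** * A smooth step function *)

Section smooth_functions.
Context {R : realType}.
Implicit Types (f g : R -> R).

Definition smooth f := forall n t, derivable (derive1n n f) t 1.

(** Coinductive proof principle: every member of a class of differentiable
    functions closed under derivation is infinitely differentiable. *)
Lemma smooth_coind (P : (R -> R) -> Prop) :
  (forall f, P f -> (forall t, derivable f t 1) /\ P (derive1 f)) ->
  forall f, P f -> smooth f.
Proof.
move=> PS f Pf n t.
suff : P (derive1n n f) by move/PS => [].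
elim: n => [//|n ih]; rewrite derive1nS; exact: (PS _ ih).2.
Qed.

Lemma smooth_derivable f t : smooth f -> derivable f t 1.
Proof. by move/(_ 0%N t). Qed.

Lemma smooth_derive1 f : smooth f -> smooth (derive1 f).
Proof. by move=> sf n t; rewrite -derive1Sn; exact: sf. Qed.

Lemma smooth_primitive f : (forall t, derivable f t 1) -> smooth (derive1 f) ->
  smooth f.
Proof. by move=> df sf [|n] t; [exact: df|rewrite derive1Sn; exact: sf]. Qed.

Lemma smooth_continuous f : smooth f -> continuous f.
Proof.
by move=> sf t; apply: differentiable_continuous; apply/derivable1_diffP; exact: smooth_derivable.
Qed.

Lemma smoothB f g : smooth f -> smooth g -> smooth (f \- g).
Proof.
move=> sf sg; apply: (@smooth_coind (fun h => exists f g,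
  [/\ smooth f, smooth g & h = f \- g])) => [_ [{sf}f [{sg}g [sf sg ->]]]|]; last by exists f, g.
have dfg (t : R) : is_derive t (1 : R) (f \- g) (derive1 f t - derive1 g t).
  by rewrite !derive1E; apply: is_deriveB; apply: derivableP; exact: smooth_derivable.
split=> [t|]; first by case: (dfg t).
exists (derive1 f), (derive1 g); split; [exact: smooth_derive1..|].
by apply/funext => t; rewrite derive1E derive_val.
Qed.

Lemma is_derive_comp_affine f (a c t : R) :
  derivable f (a * t + c) 1 ->
  is_derive t (1 : R) (fun x : R => f (a * x + c)) (a * derive1 f (a * t + c)).
Proof.
move=> df; rewrite derive1E mulrC.
have /= H := @is_derive1_comp _ f (fun x => a * x + c) t _ a (derivableP df).
by apply: H; apply: is_derive_eq; rewrite addr0 [LHS]mulr1.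
Qed.

Lemma smooth_comp_affine f (k a c : R) : smooth f ->
  smooth (fun x => k * f (a * x + c)).
Proof.
move=> sf; apply: (@smooth_coind (fun h => exists f k,
  smooth f /\ h = fun x => k * f (a * x + c))) => [_ [{sf k}f [k [sf ->]]]|]; last by exists f, k.
have dh (t : R) : is_derive t (1 : R) (fun x => k * f (a * x + c)) (k * (a * derive1 f (a * t + c))).
  apply: is_deriveZ; apply: is_derive_comp_affine; exact: smooth_derivable.
split=> [t|]; first by case: (dh t).
exists (derive1 f), (k * a); split; first exact: smooth_derive1.
by apply/funext => t; rewrite derive1E derive_val mulrA.
Qed.

End smooth_functions.

Section flat_functions.
Context {R : realType}.
Implicit Types (p : {poly R}) (k : nat).

(** The functions [p(x) y^k exp(-y)] with [y = 1 / (x (1 - x))], extended by [0]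
    outside the unit interval.  The bump [exp(-y)] is the case [p = 1], [k = 0];
    allowing polynomial numerators and powers of [y] makes the class closed
    under derivation. *)
Definition flat p k (x : R) : R :=
  if (0 < x) && (x < 1) then
    p.[x] * (x * (1 - x))^-1 ^+ k * expR (- (x * (1 - x))^-1)
  else 0.

(** [exp y >= y^(k+2) / (k+2)!], hence [y^k exp(-y) <= (k+2)! y^-2], and
    [y^-2 = (x (1 - x))^2] vanishes to second order at both endpoints. *)
Lemma flat_bound p k : exists2 C, 0 <= C &
  forall x, `|flat p k x| <= C * x ^+ 2 /\ `|flat p k x| <= C * (1 - x) ^+ 2.
Proof.
pose P := \sum_(i < size p) `|p`_i|.
have P0 : 0 <= P by exact: sumr_ge0.
exists (P * (k.+2)`!%:R); first by rewrite mulr_ge0.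
move=> x; rewrite /flat; case: ifPn => [/andP[x0 x1]|_]; last first.
  by rewrite normr0; split; rewrite mulr_ge0 ?sqr_ge0// mulr_ge0.
have xx0 : 0 < x * (1 - x) by rewrite mulr_gt0// subr_gt0.
have px : `|p.[x]| <= P.
  rewrite horner_coef (le_trans (ler_norm_sum _ _ _))//.
  apply: ler_sum => i _; rewrite normrM ler_piMr// normrX exprn_ile1//.
  by rewrite ger0_norm ltW.
suff H : `|p.[x] * (x * (1 - x))^-1 ^+ k * expR (- (x * (1 - x))^-1)| <=
    P * (k.+2)`!%:R * (x * (1 - x)) ^+ 2.
  have Pk : 0 <= P * (k.+2)`!%:R by rewrite mulr_ge0.
  by split; apply: (le_trans H); rewrite ler_wpM2l// exprMn ?ler_piMr ?ler_piMl ?sqr_ge0//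
     exprn_ile1//; lra.
set y := (x * (1 - x))^-1; have y0 : 0 < y by rewrite invr_gt0.
have -> : x * (1 - x) = y^-1 by rewrite invrK.
rewrite !normrM -mulrA -mulrA ler_pM//.
rewrite normrX !gtr0_norm ?expR_gt0//.
rewrite expRN ler_pdivrMr ?expR_gt0//.
have /= := expR_ge1Dxn k.+1 (ltW y0).
have k0 : 0 < (k.+2)`!%:R :> R by rewrite ltr0n fact_gt0.
have yk := exprn_gt0 k y0.
move=> H; have : y ^+ k.+2 / k.+2`!%:R <= expR y by lra.
rewrite ler_pdivrMr// => {}H.
rewrite -(ler_pM2r (exprn_gt0 2 y0)) -exprD addn2 (le_trans H)//.
rewrite exprVn [X in _ <= X](_ : _ = expR y * k.+2`!%:R)//.
field; lra.
Qed.

(** This settles differentiability of [flat] at the endpoints, where its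
    formula changes. *)
Lemma is_derive_quadratic_bound (f : R -> R) (a C : R) :
  (forall z, `|f z| <= C * (z - a) ^+ 2) -> is_derive a (1 : R) f 0.
Proof.
move=> fC.
have fa : f a = 0.
  by apply/eqP; rewrite -normr_le0 (le_trans (fC a))// subrr expr0n mulr0.
have C0 : 0 <= C.
  by have := le_trans (normr_ge0 _) (fC (a + 1)); rewrite [a + 1]addrC addrK expr1n mulr1.
suff H : (fun h : R => h^-1 *: (f (h *: (1:R) + a) - f a)) @ 0^' --> (0 : R).
  by apply: DeriveDef; [apply/cvg_ex; exists 0|exact/cvg_lim].
have C1 : 0 < C + 1 by rewrite ltr_wpDl.
apply/cvgrPdist_le => e e0; near=> h.
have h0 : h != 0 by near: h; exact: nbhs_dnbhs_neq.
rewrite fa subr0 sub0r normrN normrZ normfV ler_pdivrMl ?normr_gt0//.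
rewrite (le_trans (fC _))// addrK -[h *: 1]/(h * 1) mulr1 -real_normK ?num_real//.
rewrite expr2 mulrCA ler_wpM2l//.
apply: (@le_trans _ _ ((C + 1) * `|h|)); first by rewrite ler_wpM2r// lerDl.
rewrite -ler_pdivlMl//.
by near: h; apply: dnbhs0_le; rewrite mulr_gt0// invr_gt0.
Unshelve. all: by end_near. Qed.

(** Numerator of the derivative of [flat p k] once [y^(k+2)] is factored out;
    note that [y' = - (1 - 2 x) y^2]. *)
Definition flat_deriv_poly p k : {poly R} :=
  p^`() * ('X * (1 - 'X)) ^+ 2 + (1 - 'X *+ 2) * p * (1 - ('X * (1 - 'X)) *+ k).

Lemma flat_is_derive p k (x : R) :
  is_derive x (1 : R) (flat p k) (flat (flat_deriv_poly p k) k.+2 x).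
Proof.
have [C C0 fC] := flat_bound p k.
have [x0|x0] := leP x 0.
  rewrite {2}/flat ltNge x0/=; apply: (@is_derive_quadratic_bound _ _ C) => z.
  have [z0|z0] := leP z 0.
    by rewrite /flat ltNge z0 normr0 mulr_ge0// sqr_ge0.
  apply: (le_trans (fC z).1); rewrite ler_wpM2l// ler_pXn2r// ?nnegrE; lra.
have [x1|x1] := leP 1 x.
  rewrite {2}/flat (ltNge x) x1 andbF; apply: (@is_derive_quadratic_bound _ _ C) => z.
  have [z1|z1] := leP 1 z.
    by rewrite /flat (ltNge z) z1 andbF normr0 mulr_ge0// sqr_ge0.
  apply: (le_trans (fC z).2); rewrite ler_wpM2l// -[(z - x) ^+ 2]sqrrN ler_pXn2r// ?nnegrE; lra.
have xn0 : x != 0 by rewrite gt_eqF.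
have yn0 : 1 - x != 0 by rewrite gt_eqF// subr_gt0.
have xx0 : x * (1 - x) != 0 by rewrite mulf_neq0.
pose F z := p.[z] * (z * (1 - z))^-1 ^+ k * expR (- (z * (1 - z))^-1).
apply: (@near_eq_is_derive _ _ _ F).
  near=> z; rewrite /flat ifT//; apply/andP; split; near: z.
  - exact: lt_nbhsr.
  - exact: lt_nbhsl.
rewrite {1}/flat ifT ?x0 ?x1//.
have dq : is_derive x (1 : R) (fun z : R => (z * (1 - z))^-1) (- (1 - x *+ 2) * (x * (1 - x)) ^- 2).
  apply: is_derive_eq; rewrite /GRing.scale/= .
  by field; rewrite xn0 yn0.
rewrite /F.
have dp : is_derive x (1 : R) (fun z : R => p.[z]) p^`().[x] := is_derive_poly p x.
pose g z : R := (z * (1 - z))^-1.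
have dE : is_derive x (1 : R) (expR \o (- g)) (expR (- g x) * ((1 - x *+ 2) * (x * (1 - x)) ^- 2)).
  apply: is_derive1_comp; apply: (is_derive_eq (is_deriveN dq)).
  by rewrite mulNr opprK.
have dk := @is_deriveX _ _ g k x 1 _ dq.
have -> : (fun z => p.[z] * (z * (1 - z))^-1 ^+ k * expR (- (z * (1 - z))^-1)) =
    (fun z => p.[z]) * g ^+ k * (expR \o (- g)).
  by apply/funext => z; rewrite !fctE.
apply: (is_derive_eq (is_deriveM (is_deriveM dp dk) dE)).
have sE (a c : R) : a *: c = a * c by [].
have -> : (g ^+ k) x = g x ^+ k by rewrite !fctE.
have -> : (fun z => p.[z]) * g ^+ k = (fun z => p.[z] * g z ^+ k).
  by apply/funext => z; rewrite !fctE.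
have -> : (expR \o - g) x = expR (- g x) by [].
have gE : (x * (1 - x)) ^- 2 = g x * g x by rewrite /g -exprVn expr2.
rewrite !sE gE -/(g x) (exprS (g x) k.+1) (exprS (g x) k) /flat_deriv_poly !(hornerE, hornerMn).
have gx : g x = (x * (1 - x))^-1 by [].
clearbody g.
move: (expR _) => E.
clear F fC dk; case: k => [|k]; first by rewrite /= mulr0n gx; field; rewrite xn0 yn0.
rewrite -[x * (1 - x) *+ k.+1]mulr_natl -pred_Sn exprS.
move: (g x ^+ k) => Z.
move: (k.+1%:R) => K /=; rewrite gx; field; rewrite xn0 yn0.
Unshelve. all: by end_near. Qed.

Lemma smooth_flat p k : smooth (flat p k).
Proof.
apply: (@smooth_coind _ (fun f => exists p k, f = flat p k)) => [_ [{}p [{}k ->]]|]; last by exists p, k.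
split=> [t|]; first by case: (flat_is_derive p k t).
exists (flat_deriv_poly p k), k.+2; apply/funext => t.
by rewrite derive1E; have := flat_is_derive p k t => H; rewrite derive_val.
Qed.

End flat_functions.

Section smooth_step.
Context {R : realType}.
Notation mu := (@lebesgue_measure R).

Let bump : R -> R := flat 1 0.

Let bump_ge0 x : 0 <= bump x.
Proof.
rewrite /bump /flat; case: ifPn => // _.
by rewrite !hornerE ?expr0 ?mul1r expR_ge0.
Qed.

Let bump_out x : ~~ ((0 < x) && (x < 1)) -> bump x = 0.
Proof. by rewrite /bump /flat => /negbTE ->. Qed.

Let bump_continuous : continuous bump.
Proof. exact/smooth_continuous/smooth_flat. Qed.

Let bump_integrable (D : set R) : measurable D -> mu.-integrable D (EFin \o bump).
Proof.
move=> mD; apply: (@integrableS _ _ _ mu setT) => //.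
have -> : EFin \o bump = (EFin \o bump) \_ `[0, 1].
  apply/funext => x; rewrite patchE; case: ifPn => [//|].
  rewrite notin_setE/= in_itv/= => x01.
  rewrite bump_out//; apply/negP => /andP[x0 x1]; apply: x01.
  by rewrite !ltW.
rewrite -integrable_mkcond//; apply: continuous_compact_integrable.
  exact: segment_compact.
by apply: continuous_subspaceT; exact: bump_continuous.
Qed.

Let F (x : R) : R := \int[mu]_(t in `]-oo, x]) bump t.

Let F_derive x : is_derive x (1 : R) F (bump x).
Proof.
have [] := @continuous_FTC1 R bump -oo%O x (x + 1) _ _ _ (@bump_continuous x).
- by rewrite ltrDl.
- exact: bump_integrable.
- by rewrite /Order.lt/=.
by move=> dF <-; rewrite derive1E; exact: derivableP.
Qed.

Let F_mvt x y : x < y -> exists2 c, c \in `]x, y[ & F y - F x = bump c * (y - x).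
Proof.
move=> xy; apply: (@MVT R F bump x y xy (fun z _ => F_derive z)).
by apply: derivable_within_continuous => z _; case: (F_derive z).
Qed.

Let F_nd x y : x <= y -> F x <= F y.
Proof.
rewrite le_eqVlt => /predU1P[->//|xy]; have [c _ E] := F_mvt xy.
by rewrite -subr_ge0 E mulr_ge0// subr_ge0 ltW.
Qed.

Let F_le0 x : x <= 0 -> F x = 0.
Proof.
move=> x0; rewrite /F (@eq_Rintegral _ _ _ mu _ (cst 0)).
  by rewrite Rintegral_cst// mul0r.
move=> t; rewrite inE/= in_itv/= => tx; apply: bump_out.
by rewrite negb_and -!leNgt (le_trans tx x0).
Qed.

Let F_ge1 x : 1 <= x -> F x = F 1.
Proof.
rewrite le_eqVlt => /predU1P[->//|x1]; have [c] := F_mvt x1.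
rewrite in_itv/= => /andP[c1 _]; rewrite bump_out ?mul0r; first by move/eqP; rewrite subr_eq0 => /eqP.
by rewrite negb_and -!leNgt (ltW c1) orbT.
Qed.

Let F1_gt0 : 0 < F 1.
Proof.
have [c] := F_mvt ltr01; rewrite (F_le0 (lexx 0)) !subr0 mulr1 => c01 ->.
move: c01; rewrite in_itv/= /bump /flat => ->.
by rewrite !hornerE ?expr0 ?mul1r expR_gt0.
Qed.

(** The step is the primitive of the bump [exp(-1 / (x (1 - x)))], normalized by
    its total mass. *)
Lemma smooth_step : exists S : R -> R, [/\ smooth S,
  forall x, x <= 0 -> S x = 0, forall x, 1 <= x -> S x = 1,
  forall x, 0 <= S x <= 1 &
  forall x, 0 <= derive1 S x /\ (~~ (0 < x < 1) -> derive1 S x = 0)].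
Proof.
pose S x := (F 1)^-1 * F x.
have dS x : is_derive x (1 : R) S ((F 1)^-1 * bump x) by exact: is_deriveZ.
have d1S x : derive1 S x = (F 1)^-1 * bump x.
  by rewrite derive1E; have := dS x => H; rewrite derive_val.
have F10 : F 1 != 0 by rewrite gt_eqF.
have SE x : S x = (F 1)^-1 * F x by [].
exists S; split.
- apply: smooth_primitive => [t|]; first by case: (dS t).
  have -> : derive1 S = (fun x => (F 1)^-1 * bump (1 * x + 0)).
    by apply/funext => x; rewrite d1S mul1r addr0.
  by apply: smooth_comp_affine; exact: smooth_flat.
- by move=> x x0; rewrite SE (F_le0 x0) mulr0.
- by move=> x x1; rewrite SE (F_ge1 x1) mulVf.
- move=> x; rewrite SE; have [x0|x0] := leP x 0; first by rewrite (F_le0 x0) mulr0 lexx ler01.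
  have Fx : 0 <= F x by rewrite -(F_le0 (lexx 0)) F_nd// ltW.
  rewrite mulr_ge0 ?invr_ge0 ?(ltW F1_gt0)//= mulrC ler_pdivrMr// mul1r.
  by have [x1|/ltW x1] := leP x 1; [exact: F_nd|rewrite (F_ge1 x1)].
- move=> x; rewrite d1S; split; first by rewrite mulr_ge0// invr_ge0 ltW.
  by move=> x01; rewrite (bump_out x01) mulr0.
Qed.

End smooth_step.

(** * The fundamental theorem of calculus for weak derivatives *)

Section interval_integrals.
Context {R : realType}.
Notation mu := (@lebesgue_measure R).

Lemma within_continuous_integrable (a b : R) (f : R -> R) :
  {within `[a, b], continuous f} -> mu.-integrable `[a, b] (EFin \o f).
Proof. by apply: continuous_compact_integrable; exact: segment_compact. Qed.

Lemma within_continuous_integrable_oo (a b : R) (f : R -> R) :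
  {within `[a, b], continuous f} -> mu.-integrable `]a, b[ (EFin \o f).
Proof.
move=> /within_continuous_integrable; apply: integrableS => //.
exact: subset_itv_oo_cc.
Qed.

Lemma Rintegral_oo_cc (a b : R) (f : R -> R) : mu.-integrable `[a, b] (EFin \o f) ->
  \int[mu]_(t in `]a, b[) f t = \int[mu]_(t in `[a, b]) f t.
Proof.
move=> fi; rewrite Rintegral_itv_bndo_bndc; last first.
  by apply: integrableS fi => //; exact: subset_itv_oo_cc.
rewrite Rintegral_itv_obnd_cbnd//; apply: integrableS fi => //.
exact: subset_itv_oc_cc.
Qed.

Lemma within_continuousM (D : set R) (f g : R -> R) :
  {within D, continuous f} -> {within D, continuous g} ->
  {within D, continuous (fun t => f t * g t)}.
Proof.
move=> /subspace_continuousP cf /subspace_continuousP cg.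
by apply/subspace_continuousP => t Dt; apply: cvgM; [exact: cf|exact: cg].
Qed.

(** Test functions can be differentiated inside weak formulations; this is how
    a second weak derivative is reached from a first one. *)
Lemma test_function_derive1 (T : R) (th : R -> R) :
  test_function T th -> test_function T (derive1 th).
Proof.
move=> [sth [a [b [a0 bT th0]]]]; split; first exact: smooth_derive1.
exists a, b; split => // t tab.
rewrite derive1E (@near_eq_derive _ _ _ _ (cst 0)) ?derive_cst//.
move: tab; rewrite in_itv/= negb_and -!ltNge => /orP[ta|bt]; near=> z; apply: th0;
  rewrite in_itv/= negb_and -!ltNge; apply/orP; [left|right]; near: z.
- exact: lt_nbhsl.
- exact: lt_nbhsr.
Unshelve. all: by end_near. Qed.

End interval_integrals.

Section weak_ftc.
Context {R : realType}.
Notation mu := (@lebesgue_measure R).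

Definition scalar_weak_derivative (T : R) (phi psi : R -> R) : Prop :=
  forall th, test_function T th ->
    \int[mu]_(t in `]0, T[) (derive1 th t * phi t) =
    - \int[mu]_(t in `]0, T[) (th t * psi t).

Lemma test_function_continuous (T : R) (th : R -> R) : test_function T th -> continuous th.
Proof. by case=> /smooth_continuous. Qed.

(** The derivative of the step rescaled to [[a, a + e]] is a nonnegative kernel
    of total mass one supported there, so its integral against [phi] is an average of
    the values of [phi] on that interval. *)
Lemma step_kernel (S : R -> R) (T a e v eta : R) (phi : R -> R) :
  smooth S -> (forall x, x <= 0 -> S x = 0) -> (forall x, 1 <= x -> S x = 1) ->
  (forall x, 0 <= derive1 S x /\ (~~ (0 < x < 1) -> derive1 S x = 0)) ->
  0 <= a -> 0 < e -> a + e <= T -> {within `[0, T], continuous phi} ->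
  (forall x, a < x < a + e -> `|phi x - v| <= eta) ->
  `|\int[mu]_(t in `]0, T[) (e^-1 * derive1 S (e^-1 * t + - (a / e)) * phi t) - v| <= eta.
Proof.
move=> sS S0 S1 dS a0 e0 aeT cphi phiv.
have T0 : 0 < T by rewrite (lt_le_trans _ aeT)// ltr_wpDl.
have eta0 : 0 <= eta.
  by apply: (le_trans (normr_ge0 _) (phiv (a + e / 2) _)); lra.
pose sg t := S (e^-1 * t + - (a / e)).
pose k t := e^-1 * derive1 S (e^-1 * t + - (a / e)).
have dsg t : is_derive t (1 : R) sg (k t).
  by apply: is_derive_comp_affine; exact: smooth_derivable.
have k0 t : 0 <= k t by rewrite mulr_ge0 ?invr_ge0 ?(ltW e0)//; case: (dS (e^-1 * t + - (a / e))).
have ck : continuous k.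
  apply: smooth_continuous; apply: (@smooth_comp_affine _ (derive1 S)).
  exact: smooth_derive1.
have ckw : {within `[0, T], continuous k} by exact: continuous_subspaceT.
have kout t : ~~ (a < t < a + e) -> k t = 0.
  move=> at_; rewrite /k (dS _).2 ?mulr0//; apply: contra at_.
  have -> : e^-1 * t + - (a / e) = (t - a) / e by field; rewrite gt_eqF.
  by rewrite ltr_pdivrMr// mul1r pmulr_lgt0 ?invr_gt0//; lra.
have ik := within_continuous_integrable ckw.
have ik1 : \int[mu]_(t in `]0, T[) k t = 1.
  rewrite Rintegral_oo_cc// /Rintegral (@continuous_FTC2 _ k sg 0 T)//.
  - have -> : sg 0 = 0 by rewrite /sg S0// mulr0 add0r oppr_le0 divr_ge0// ltW.
    have -> : sg T = 1; last by rewrite -EFinB subr0.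
    rewrite /sg; have -> : e^-1 * T + - (a / e) = (T - a) / e by field; rewrite gt_eqF.
    by rewrite S1// ler_pdivlMr// mul1r; lra.
  - have csg : continuous sg.
      by move=> t; apply: differentiable_continuous; apply/derivable1_diffP; case: (dsg t).
    split; first by move=> t _; case: (dsg t).
    + apply: cvg_at_right_filter; exact: csg.
    + apply: cvg_at_left_filter; exact: csg.
  - by move=> t _; rewrite derive1E; have := dsg t => H; rewrite derive_val.
have cp : {within `[0, T], continuous (fun t => k t * (phi t - v))}.
  apply: within_continuousM => //; apply/subspace_continuousP => t Dt; apply: cvgB; last exact: cvg_cst.
  by move/subspace_continuousP : cphi; exact.
have -> : \int[mu]_(t in `]0, T[) (k t * phi t) - v =
    \int[mu]_(t in `]0, T[) (k t * (phi t - v)).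
  rewrite -[in LHS](mulr1 v) -ik1 -RintegralZl//; last exact: within_continuous_integrable_oo.
  rewrite -RintegralB//.
  - by apply: eq_Rintegral => t _; rewrite mulrBr (mulrC v).
  - by apply: within_continuous_integrable_oo; exact: within_continuousM.
  - apply: within_continuous_integrable_oo; apply: within_continuousM => //.
    by apply: continuous_subspaceT => t; exact: cvg_cst.
have cpo := within_continuous_integrable_oo cp.
apply: (le_trans (le_normr_Rintegral _ cpo)) => //.
rewrite -[leRHS]mulr1 -ik1 -RintegralZl//; last exact: within_continuous_integrable_oo.
apply: le_Rintegral => //.
- exact: integrable_norm cpo.
- apply: within_continuous_integrable_oo; apply: within_continuousM => //.
  by apply: continuous_subspaceT => t; exact: cvg_cst.
move=> t _; rewrite normrM (ger0_norm (k0 t)) mulrC.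
have [tin|tout] := boolP (a < t < a + e); last by rewrite kout// !mulr0.
by rewrite ler_wpM2r// phiv.
Qed.

(** Test with smoothed indicators [th n] of [[s, t]], differences of two
    rescaled steps.  Their derivatives are approximate Dirac masses at [s] and
    [t], which by continuity of [phi] produce [phi s - phi t]; dominated
    convergence handles the side of [psi].  The steps are placed strictly inside
    [[s, t]], so that the endpoints [s = 0] and [t = T] are covered. *)
Lemma weak_ftc (T : R) (phi psi : R -> R) :
  {within `[0, T], continuous phi} -> mu.-integrable `]0, T[ (EFin \o psi) ->
  scalar_weak_derivative T phi psi ->
  forall s t, 0 <= s -> s <= t -> t <= T ->
    phi t - phi s = \int[mu]_(x in `]s, t[) psi x.
Proof.
move=> cphi ipsi wd s t s0; rewrite le_eqVlt => /predU1P[->|st] tT.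
  by rewrite subrr set_itvoo0 Rintegral_set0.
have [S [sS S0 S1 S01 dS]] := @smooth_step R.
(* The rising step occupies [s + e, s + 2 e] and the falling one
[t - 2 e, t - e]; they stay apart as long as [4 e <= t - s]. *)
pose del := (t - s) / 4; have del0 : 0 < del by rewrite /del; lra.
pose e n : R := del / n.+1%:R.
have e0 n : 0 < e n by rewrite divr_gt0.
have e_le n : e n <= del by rewrite ler_pdivrMr// ler_peMr ?ler1n// ltW.
have e4 n : 4 * e n <= t - s.
  by have := e_le n; rewrite /del; lra.
have e_cvg : e @ \oo --> 0.
  rewrite /e -(mulr0 del); apply: cvgMr; exact: cvg_harmonic.
pose sg n a x := S ((e n)^-1 * x + - (a / e n)).
have sgE n a x : (e n)^-1 * x + - (a / e n) = (x - a) / e n.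
  by field; rewrite gt_eqF.
have sg_le n a x : x <= a -> sg n a x = 0.
  by move=> xa; rewrite /sg S0// sgE pmulr_lle0 ?invr_gt0// subr_le0.
have sg_ge n a x : a + e n <= x -> sg n a x = 1.
  by move=> xa; rewrite /sg S1// sgE ler_pdivlMr// mul1r; lra.
pose th n x := sg n (s + e n) x - sg n (t - 2 * e n) x.
have ssg n a : smooth (sg n a).
  have -> : sg n a = (fun x => 1 * S ((e n)^-1 * x + - (a / e n))).
    by apply/funext => x; rewrite mul1r.
  exact: smooth_comp_affine.
have th_test n : test_function T (th n).
  split; first exact: smoothB (ssg _ _) (ssg _ _).
  have en := e0 n; have e4n := e4 n.
  exists (s + e n), (t - e n); split; [lra|lra|].
  move=> x; rewrite in_itv/= negb_and -!ltNge /th => /orP[xs|xt].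
    by rewrite !sg_le ?subrr//; lra.
  by rewrite !sg_ge ?subrr//; lra.
have th1 n x : `|th n x| <= 1.
  have := S01 ((e n)^-1 * x + - ((s + e n) / e n)).
  have := S01 ((e n)^-1 * x + - ((t - 2 * e n) / e n)).
  rewrite /th /sg => /andP[? ?] /andP[? ?]; rewrite ler_norml; lra.
have dth n x : derive1 (th n) x =
    (e n)^-1 * derive1 S ((e n)^-1 * x + - ((s + e n) / e n)) -
    (e n)^-1 * derive1 S ((e n)^-1 * x + - ((t - 2 * e n) / e n)).
  have H : is_derive x (1 : R) (th n) ((e n)^-1 * derive1 S ((e n)^-1 * x + - ((s + e n) / e n)) -
    (e n)^-1 * derive1 S ((e n)^-1 * x + - ((t - 2 * e n) / e n))).
    by apply: is_deriveB; apply: is_derive_comp_affine; exact: smooth_derivable.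
  by rewrite derive1E derive_val.
pose I n a := \int[mu]_(x in `]0, T[) ((e n)^-1 * derive1 S ((e n)^-1 * x + - (a / e n)) * phi x).
have thphi n : \int[mu]_(x in `]0, T[) (derive1 (th n) x * phi x) =
    I n (s + e n) - I n (t - 2 * e n).
  rewrite -RintegralB//; first by apply: eq_Rintegral => x _; rewrite dth mulrBl.
  - apply: within_continuous_integrable_oo; apply: within_continuousM => //.
    apply: continuous_subspaceT; apply: smooth_continuous.
    by apply: (@smooth_comp_affine _ (derive1 S)); exact: smooth_derive1.
  - apply: within_continuous_integrable_oo; apply: within_continuousM => //.
    apply: continuous_subspaceT; apply: smooth_continuous.
    by apply: (@smooth_comp_affine _ (derive1 S)); exact: smooth_derive1.
have I_cvg (a : nat -> R) y : 0 <= y <= T -> (forall n, 0 <= a n) -> (forall n, a n + e n <= T) ->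
    (forall n, `|a n - y| <= 2 * e n) -> (fun n => I n (a n)) @ \oo --> phi y.
  move=> yT an0 anT any; apply/cvgrPdist_le => /= eta eta0.
  have /subspace_continuousP/(_ y) := cphi; rewrite /= in_itv/= => /(_ yT).
  move=> /cvgrPdist_le/(_ _ eta0) H.
  have /nbhs_ballP[d /= d0 yd] :
    \forall x \near y, [set` `[0, T]] x -> `|phi y - phi x| <= eta := H.
  have d3 : 0 < d / 3 by rewrite divr_gt0.
  move/cvgrPdist_lt : e_cvg => /(_ _ d3); apply: filterS => n.
  rewrite sub0r normrN gtr0_norm// => end3.
  rewrite distrC; apply: (step_kernel sS S0 S1 dS (an0 n) (e0 n) (anT n) cphi) => x /andP[ax xa].
  rewrite distrC; apply: yd.
    have := any n; rewrite /ball/= ler_norml ltr_norml; lra.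
  by rewrite /= in_itv/=; have := an0 n; have := anT n; lra.
have cvgL : (fun n => \int[mu]_(x in `]0, T[) (derive1 (th n) x * phi x)) @ \oo --> phi s - phi t.
  rewrite (funext thphi); apply: cvgB; apply: I_cvg => [|n|n|n]; try have := e4 n;
    try have := e0 n; rewrite ?ler_norml; lra.
have cvgR : (fun n => \int[mu]_(x in `]0, T[) (th n x * psi x)) @ \oo -->
    \int[mu]_(x in `]s, t[) psi x.
  have mpsi : measurable_fun `]0, T[ psi by apply/measurable_EFinP; exact: measurable_int ipsi.
  have sub : `]s, t[ `<=` (`]0, T[ : set R).
    by move=> x; rewrite /= !in_itv/=; lra.
  have -> : \int[mu]_(x in `]s, t[) psi x = \int[mu]_(x in `]0, T[) (psi \_ `]s, t[) x.
    by rewrite -Rintegral_mkcondr; congr Rintegral; rewrite setIidr.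
  have mth n : measurable_fun `]0, T[ (fun x => th n x * psi x).
    apply: measurable_funM => //; apply: measurable_funTS.
    by apply: continuous_measurable_fun; exact: test_function_continuous (th_test n).
  have mlim : measurable_fun `]0, T[ (psi \_ `]s, t[).
    apply/(measurable_restrict _ (measurable_itv _) (measurable_itv _)).
    by apply: measurable_funS mpsi => // x [].
  have [] := @dominated_convergence _ _ R mu `]0, T[ (measurable_itv _)
    (fun n x => (th n x * psi x)%:E) (EFin \o (psi \_ `]s, t[)) (abse \o (EFin \o psi)).
  - by move=> n; apply/measurable_EFinP; exact: mth.
  - by apply/measurable_EFinP; exact: mlim.
  - apply: aeW => x _; apply: cvg_near_cst.
    have [/andP[sx xt]|out] := boolP (s < x < t).
      have m0 : 0 < Num.min (x - s) (t - x) / 2.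
        by rewrite divr_gt0// lt_min !subr_gt0 sx.
      move/cvgrPdist_lt : e_cvg => /(_ _ m0); apply: filterS => n.
      rewrite sub0r normrN gtr0_norm// ltr_pdivlMr// lt_min => /andP[e1 e2].
      rewrite /th sg_ge ?sg_le ?subr0 ?mul1r//=; [|lra..].
      by rewrite patchE mem_set//= in_itv/= sx.
    apply: nearW => n /=; rewrite patchE memNset/=; last first.
      by rewrite in_itv/=; exact/negP.
    have := e4 n; have := e0 n => en e4n.
    move: out; rewrite negb_and -!leNgt /th => /orP[xs|tx].
      by rewrite !sg_le ?subrr ?mul0r//; lra.
    by rewrite !sg_ge ?subrr ?mul0r//; lra.
  - exact: integrable_abse ipsi.
  - apply: aeW => x n _; rewrite /= lee_fin normrM ler_piMl//; exact: th1.
  move=> ilim _ H; apply: fine_cvg; rewrite /Rintegral fineK; first exact: H.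
  exact: integrable_fin_num ilim.
apply: oppr_inj; rewrite opprB -(cvg_lim _ cvgL)//.
rewrite -(cvg_lim _ (cvgN cvgR))//; congr (lim (_ @ \oo)).
by apply/funext => n; exact: wd.
Qed.

(** Integration by parts on [[0, T]]; the boundary terms vanish with the test
    function. *)
Lemma test_function_ibp (T : R) (th F f : R -> R) : 0 < T -> test_function T th ->
  {within `[0, T], continuous F} -> {within `[0, T], continuous f} ->
  (forall t, t \in `]0, T[ -> is_derive t (1 : R) F (f t)) ->
  \int[mu]_(t in `]0, T[) (F t * derive1 th t) = - \int[mu]_(t in `]0, T[) (f t * th t).
Proof.
move=> T0 tht cF cf dF; have [sth [a [b [a0 bT th0]]]] := tht.
have cth := test_function_continuous tht.
have cdth := test_function_continuous (test_function_derive1 tht).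
have FLR : derivable_oo_LRcontinuous F 0 T.
  have [_ FR FL] := (continuous_within_itvP F T0).1 cF.
  by split => // t tT; case: (dF _ tT).
rewrite !Rintegral_oo_cc.
- rewrite (@Rintegration_by_parts _ F th f (derive1 th) 0 T)//.
  + rewrite !th0 ?mulr0 ?subrr ?sub0r// in_itv/= negb_and -!ltNge ?a0 ?bT ?orbT//.
  + by move=> t tT; have := dF _ tT => H; rewrite derive1E derive_val.
  + exact: continuous_subspaceT.
  + split; first by move=> t _; exact: smooth_derivable.
    * by apply: cvg_at_right_filter; exact: cth.
    * by apply: cvg_at_left_filter; exact: cth.
- by apply: within_continuous_integrable; apply: within_continuousM => //; exact: continuous_subspaceT.
- by apply: within_continuous_integrable; apply: within_continuousM => //; exact: continuous_subspaceT.
Qed.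

End weak_ftc.

(** * Orthonormal families and the Fortin projection *)

Section subspaces.
Context {R : realType}.

Lemma finite_dim_subspace_closed (E : normedModType R) (S : set E) :
  finite_dim_subspace S -> S 0 /\ forall a x y, S x -> S y -> S (a *: x + y).
Proof.
move=> [n [e ->]]; split.
  by exists (fun=> 0) => //; rewrite big1// => i _; rewrite scale0r.
move=> a x y [c _ <-] [d _ <-]; exists (fun i => a * c i + d i) => //.
by rewrite scaler_sumr -big_split/=; apply: eq_bigr => i _; rewrite scalerDl scalerA.
Qed.

Lemma subspace_sum (E : lmodType R) (S : set E) (I : eqType) (s : seq I)
    (c : I -> R) (F : I -> E) :
  S 0 -> (forall a x y, S x -> S y -> S (a *: x + y)) ->
  (forall i, i \in s -> S (F i)) -> S (\sum_(i <- s) c i *: F i).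
Proof.
move=> S0 SD sS; rewrite big_seq; elim/big_ind : _ => // [v w ? ?|i si].
  by rewrite -(scale1r v); exact: SD.
by rewrite -[_ *: _]addr0; apply: SD => //; exact: sS.
Qed.

End subspaces.

Section inner_product.
Context {R : realType} {X : normedModType R} (ip : X -> X -> R).

(** Kept as a property of a plain real function, since only its
    algebraic laws matter below. *)
Record inner_product : Prop := InnerProduct {
  ipPl : forall a x y z, ip (a *: x + y) z = a * ip x z + ip y z;
  ipC : forall x y, ip x y = ip y x;
  ipxx : forall x, ip x x = `|x| ^+ 2 }.

Context (ipP : inner_product).

Lemma ip0l z : ip 0 z = 0.
Proof. by have := ipPl ipP (-1) 0 0 z; rewrite scaler0 addr0 mulN1r addNr. Qed.

Lemma ipZl a x z : ip (a *: x) z = a * ip x z.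
Proof. by have := ipPl ipP a x 0 z; rewrite addr0 ip0l addr0. Qed.

Lemma ipDl x y z : ip (x + y) z = ip x z + ip y z.
Proof. by have := ipPl ipP 1 x y z; rewrite scale1r mul1r. Qed.

Lemma ipBl x y z : ip (x - y) z = ip x z - ip y z.
Proof. by rewrite ipDl -scaleN1r ipZl mulN1r. Qed.

Lemma ip_suml (I : Type) (r : seq I) (F : I -> X) z :
  ip (\sum_(i <- r) F i) z = \sum_(i <- r) ip (F i) z.
Proof. exact: (big_morph (ip^~ z) (fun x y => ipDl x y z) (ip0l z)). Qed.

Lemma ip_sumZl (I : Type) (r : seq I) (c : I -> R) (F : I -> X) z :
  ip (\sum_(i <- r) c i *: F i) z = \sum_(i <- r) c i * ip (F i) z.
Proof. by rewrite ip_suml; apply: eq_bigr => i _; rewrite ipZl. Qed.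

Lemma ip_cauchy_schwarz x y : `|ip x y| <= `|x| * `|y|.
Proof.
have [->|y0] := eqVneq y 0; first by rewrite (ipC ipP) ip0l !normr0 mulr0.
have ny : 0 < `|y| ^+ 2 by rewrite exprn_gt0// normr_gt0.
rewrite -ler_sqr ?nnegrE ?mulr_ge0// real_normK ?num_real// exprMn -ler_pdivrMr//.
have expand c : ip (x - c *: y) (x - c *: y) = `|x| ^+ 2 - 2 * c * ip x y + c ^+ 2 * `|y| ^+ 2.
  have e1 z : ip z (x - c *: y) = ip x z - c * ip y z.
    by rewrite (ipC ipP) ipBl ipZl.
  by rewrite ipBl ipZl !e1 !(ipxx ipP) (ipC ipP y x); ring.
have := sqr_ge0 `|x - (ip x y / `|y| ^+ 2) *: y|.
rewrite -(ipxx ipP (x - _)) expand => H; rewrite -subr_ge0; apply: le_trans H _.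
rewrite le_eqVlt; apply/orP; left; apply/eqP; field.
by rewrite normr_eq0.
Qed.

(** Stated along a list, the shape in which Gram-Schmidt produces and consumes
    it. *)
Fixpoint orthonormal (s : seq X) : Prop :=
  if s is x :: s' then
    [/\ ip x x = 1, forall y, y \in s' -> ip x y = 0 & orthonormal s']
  else True.

Lemma ip_orthonormal_sum s (c : X -> R) y : orthonormal s -> y \in s ->
  ip (\sum_(x <- s) c x *: x) y = c y.
Proof.
elim: s => [//|x s ih] [xx1 xs0 sO]; rewrite in_cons big_cons ipDl ipZl.
have [->|yx]/= := eqVneq y x.
  move=> _; rewrite xx1 mulr1 ip_sumZl big_seq big1 ?addr0// => z zs.
  by rewrite (ipC ipP) xs0// mulr0.
by move=> ys; rewrite xs0// mulr0 add0r ih.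
Qed.

Definition fspan n (e : 'I_n -> X) : set X :=
  [set \sum_(i < n) c i *: e i | c in [set: 'I_n -> R]].

(** Vectors are adjoined one at a time: [w] is the new one minus its projection
    onto the span of the family found so far, and is normalized unless it is zero. *)
Lemma gram_schmidt n (e : 'I_n -> X) : exists s : seq X, [/\ orthonormal s,
  forall x, x \in s -> fspan e x &
  forall v, fspan e v -> v = \sum_(x <- s) ip v x *: x].
Proof.
elim: n e => [|n ih] e.
  exists [::]; split => // v [c _ <-].
  by rewrite big_ord0 big_nil.
have [s [sO se es]] := ih (fun i => e (widen_ord (leqnSn n) i)).
have sub v : fspan (fun i => e (widen_ord (leqnSn n) i)) v -> fspan e v.
  move=> [c _ <-]; exists (fun i => if insub (val i) is Some k then c k else 0) => //.
  rewrite big_ord_recr/= insubF ?ltnn// scale0r addr0.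
  by apply: eq_bigr => i _; rewrite insubT//= => i0; congr (c _ *: _); exact: val_inj.
have [span0 spanD] : fspan e 0 /\
    forall a v w, fspan e v -> fspan e w -> fspan e (a *: v + w).
  by apply: finite_dim_subspace_closed; exists n.+1, e.
pose w := e ord_max - \sum_(x <- s) ip (e ord_max) x *: x.
have spans (c : X -> R) : fspan e (\sum_(x <- s) c x *: x).
  by apply: subspace_sum => // x xs; apply: sub; exact: se.
have emax : fspan e (e ord_max).
  exists (fun i => (i == ord_max)%:R) => //.
  rewrite (bigD1 ord_max)//= eqxx scale1r big1 ?addr0// => i /negbTE ->.
  by rewrite scale0r.
have wsp : fspan e w by rewrite /w addrC -scaleN1r; exact: spanD.
have wO x : x \in s -> ip w x = 0.
  by move=> xs; rewrite /w ipBl ip_orthonormal_sum// subrr.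
have eE v : fspan e v -> exists c v', fspan (fun i => e (widen_ord (leqnSn n) i)) v' /\
    v = c *: w + (v' + \sum_(x <- s) (c * ip (e ord_max) x) *: x).
  move=> [c _ <-]; exists (c ord_max), (\sum_(i < n) c (widen_ord (leqnSn n) i) *: e (widen_ord (leqnSn n) i)).
  split; first by exists (fun i => c (widen_ord (leqnSn n) i)).
  have -> : \sum_(x <- s) (c ord_max * ip (e ord_max) x) *: x =
      c ord_max *: \sum_(x <- s) ip (e ord_max) x *: x.
    by rewrite scaler_sumr; apply: eq_bigr => x _; rewrite scalerA.
  by rewrite big_ord_recr/= /w scalerBr addrCA subrK.
have [w0|w0] := eqVneq w 0.
  exists s; split => // [x xs|v /eE[c [v' [v'e ->]]]]; first exact/sub/se.
  rewrite w0 scaler0 add0r {1}(es _ v'e) -big_split/= [LHS]big_seq [RHS]big_seq.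
  apply: eq_bigr => x xs; rewrite -scalerDl ipDl; congr ((_ + _) *: _).
  by rewrite (ip_orthonormal_sum (fun x => c * ip (e ord_max) x)).
pose w1 := `|w|^-1 *: w.
have nw : `|w| != 0 by rewrite normr_eq0.
have w1s x : x \in s -> ip w1 x = 0 by move=> xs; rewrite ipZl wO// mulr0.
have w11 : ip w1 w1 = 1.
  by rewrite ipZl (ipC ipP) ipZl (ipxx ipP); field.
exists (w1 :: s); split => /=.
- by split.
- move=> x; rewrite in_cons => /predU1P[->|xs]; last exact/sub/se.
  by rewrite /w1 -[_ *: _]addr0; exact: spanD.
move=> v /eE[c [v' [v'e ->]]]; rewrite big_cons.
set v'' := v' + _.
have v''E : v'' = \sum_(x <- s) ip v'' x *: x.
  rewrite {1}/v'' {1}(es _ v'e) -big_split/= [LHS]big_seq [RHS]big_seq.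
  apply: eq_bigr => x xs; rewrite -scalerDl ipDl; congr ((_ + _) *: _).
  by rewrite (ip_orthonormal_sum (fun x => c * ip (e ord_max) x)).
have v''w1 : ip v'' w1 = 0.
  rewrite v''E ip_sumZl big_seq big1// => x xs.
  by rewrite (ipC ipP x) w1s// mulr0.
congr (_ + _).
  rewrite ipDl v''w1 addr0 ipZl (ipC ipP w) ipZl (ipxx ipP) scalerA.
  by congr (_ *: _); field.
rewrite {1}v''E [LHS]big_seq [RHS]big_seq; apply: eq_bigr => x xs.
by congr (_ *: _); rewrite [RHS]ipDl ipZl wO// mulr0 add0r.
Qed.

End inner_product.

Section fortin.
Context {R : realType} {X M : normedModType R}.

Lemma hilbertian_inner_product (Z : completeNormedModType R) :
  hilbertian Z -> exists ip : Z -> Z -> R, inner_product ip.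
Proof.
move=> [ip ipE]; exists ip; split=> [a x y z|x y|x]; last exact: ipE.
  by rewrite linearPl.
by rewrite (hermitian_subproof (s := ip)) expr0 mul1r.
Qed.

(** The form in which best approximation is used: a bound valid for every
    competitor [z] passes to the infimum. *)
Lemma le_dist_to (S : set X) (x : X) (c C : R) : S 0 -> 0 <= C ->
  (forall z, S z -> c <= C * `|x - z|) -> c <= C * dist_to S x.
Proof.
move=> S0; rewrite le_eqVlt => /predU1P[<-|C0] H.
  by rewrite mul0r; have := H _ S0; rewrite mul0r.
rewrite -ler_pdivrMl//; apply: lb_le_inf; first by exists `|x - 0|, 0.
by move=> _ [z Sz <-]; rewrite ler_pdivrMl// H.
Qed.

Lemma dist_to_le (S : set X) (x z : X) : S z -> dist_to S x <= `|x - z|.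
Proof.
move=> Sz; apply: ge_inf; last by exists z.
by exists 0 => _ [y _ <-].
Qed.

Lemma dist_to_ge0 (S : set X) (x : X) : 0 <= dist_to S x.
Proof.
have [[z Sz]|S0] := pselect (exists z, S z).
  by apply: lb_le_inf; [exists `|x - z|, z|move=> _ [y _ <-]].
rewrite /dist_to (_ : [set _ | z in S] = set0) ?inf0//.
by apply/seteqP; split=> // t [z Sz _]; exfalso; apply: S0; exists z.
Qed.

Context (ip : X -> X -> R) (ipP : inner_product ip).
Context (b : X -> M -> R) (Cb : R).
Context (bl : forall a x y m, b (a *: x + y) m = a * b x m + b y m).
Context (br : forall a x m n, b x (a *: m + n) = a * b x m + b x n).
Context (b_bounded : forall v m, `|b v m| <= Cb * `|v| * `|m|).

Let b0l m : b 0 m = 0.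
Proof. by have := bl (-1) 0 0 m; rewrite scaler0 addr0 mulN1r addNr. Qed.

Let b0r x : b x 0 = 0.
Proof. by have := br (-1) x 0 0; rewrite scaler0 addr0 mulN1r addNr. Qed.

Let bBl x y m : b (x - y) m = b x m - b y m.
Proof. by rewrite addrC -scaleN1r bl mulN1r addrC. Qed.

Let bBr x m n : b x (m - n) = b x m - b x n.
Proof. by rewrite addrC -scaleN1r br mulN1r addrC. Qed.

Let b_sumZl (I : Type) (r : seq I) (c : I -> R) (F : I -> X) m :
  b (\sum_(i <- r) c i *: F i) m = \sum_(i <- r) c i * b (F i) m.
Proof.
elim: r => [|i r ih]; first by rewrite !big_nil b0l.
by rewrite !big_cons bl ih.
Qed.

Let b_sumZr (I : Type) (r : seq I) (c : I -> R) (F : I -> M) x :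
  b x (\sum_(i <- r) c i *: F i) = \sum_(i <- r) c i * b x (F i).
Proof.
elim: r => [|i r ih]; first by rewrite !big_nil b0r.
by rewrite !big_cons br ih.
Qed.

(** Let [Q] be the orthogonal projection onto [Xh] and [G q] in [Xh] the Riesz
    representative of [b . q].  The inf-sup condition says that
    [beta |q| <= |G q|], so on the range [G Mh], with orthonormal basis
    [x = G (q_ x)], the vector [z w = \sum b w (q_ x) x] satisfies
    [b (z w) m = <G m, z w> = b w m] for [m] in [Mh] and
    [|z w| <= Cb / beta |w|].  Then [P v = Q v + z (v - Q v)] corrects the defect
    of [Q] in the constraint.  Since [|v - Q v|] is the distance from [v] to
    [Xh], the constant depends on [b] and [beta] only. *)
Lemma fortin_operator (Xh : set X) (Mh : set M) (beta : R) :
  finite_dim_subspace Xh -> finite_dim_subspace Mh -> 0 < beta -> 0 <= Cb ->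
  inf_sup b Xh Mh beta ->
  exists P : X -> X, [/\ forall a x y, P (a *: x + y) = a *: P x + P y,
    forall v, Xh (P v),
    forall v m, Mh m -> b (P v) m = b v m &
    forall v, `|v - P v| <= (1 + Cb / beta) * dist_to Xh v].
Proof.
move=> Xfin Mfin beta0 Cb0 infsup.
have [Xh0 XhD] := finite_dim_subspace_closed Xfin.
have [Mh0 MhD] := finite_dim_subspace_closed Mfin.
have [nx [ex XhE]] := Xfin; have [nm [em MhE]] := Mfin.
have [bX [bXO bXe ebX]] := gram_schmidt ipP ex.
have Xho x : x \in bX -> Xh x by rewrite XhE; exact: bXe.
have Xhsum (s : seq X) (c : X -> R) : (forall x, x \in s -> Xh x) ->
    Xh (\sum_(x <- s) c x *: x) by exact: subspace_sum.
have Mhsum (s : seq X) (c : X -> R) (F : X -> M) :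
    (forall x, x \in s -> Mh (F x)) -> Mh (\sum_(x <- s) c x *: F x).
  exact: subspace_sum.
pose Q v := \sum_(x <- bX) ip v x *: x.
have Qid v : Xh v -> v = Q v by rewrite XhE => /ebX.
have QX v : Xh (Q v) by exact: Xhsum.
have Qlin a x y : Q (a *: x + y) = a *: Q x + Q y.
  rewrite /Q scaler_sumr -big_split/=; apply: eq_bigr => z _.
  by rewrite (ipPl ipP) scalerDl scalerA.
have Qorth v w : Xh w -> ip (v - Q v) w = 0.
  move=> /Qid ->; rewrite (ipC ipP) ip_sumZl// big_seq big1// => x xo.
  by rewrite (ipC ipP x (v - _)) ipBl// ip_orthonormal_sum// subrr mulr0.
have Qbest v z : Xh z -> `|v - Q v| <= `|v - z|.
  move=> Xz; have H : ip (v - Q v) (v - z) = `|v - Q v| ^+ 2.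
    have XQz : Xh (Q v - z) by rewrite addrC -scaleN1r; exact: XhD.
    have -> : v - z = (v - Q v) + (Q v - z) by rewrite addrA subrK.
    by rewrite (ipC ipP) ipDl// (ipC ipP (Q v - z)) (Qorth _ _ XQz) addr0 (ipxx ipP).
  have [->|v0] := eqVneq (v - Q v) 0; first by rewrite normr0.
  have := le_trans (ler_norm _) (ip_cauchy_schwarz ipP (v - Q v) (v - z)).
  by rewrite H expr2 ler_pM2l// normr_gt0.
pose G q := \sum_(x <- bX) b x q *: x.
have GX q : Xh (G q) by exact: Xhsum.
have GE q v : Xh v -> ip (G q) v = b v q.
  move=> /Qid {2}->; rewrite ip_sumZl// b_sumZl; apply: eq_bigr => x _.
  by rewrite mulrC (ipC ipP).
have Gsum (I : Type) (s : seq I) (c : I -> R) (F : I -> M) :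
    G (\sum_(i <- s) c i *: F i) = \sum_(i <- s) c i *: G (F i).
  rewrite /G; under eq_bigr do rewrite b_sumZr scaler_suml.
  rewrite exchange_big/=; apply: eq_bigr => i _; rewrite scaler_sumr.
  by apply: eq_bigr => x _; rewrite scalerA.
have Gbelow q : Mh q -> beta * `|q| <= `|G q|.
  move=> Mq; apply: (le_trans (infsup _ Mq)).
  have [[v [Xv v0]]|E] := pselect (exists v, Xh v /\ v != 0); last first.
    rewrite (_ : [set _ | _ in _] = set0) ?sup0//.
    by apply/seteqP; split=> // t [v Xv _]; exfalso; apply: E; exists v.
  apply: ge_sup; first by exists (b v q / `|v|), v.
  move=> _ [{Xv v0}v [Xv v0] <-]; rewrite ler_pdivrMr ?normr_gt0// -GE//.
  by rewrite (le_trans (ler_norm _))// ip_cauchy_schwarz.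
have [s [sO sG Gs]] := gram_schmidt ipP (fun i => G (em i)).
have spanG q : Mh q -> fspan (fun i => G (em i)) (G q).
  by rewrite MhE => -[c _ <-]; exists c => //; rewrite Gsum.
have /choice[q_ qP] : forall x, exists q, x \in s -> Mh q /\ G q = x.
  move=> x; have [xs|xs] := boolP (x \in s); last by exists 0.
  have [c _ cE] := sG _ xs; exists (\sum_i c i *: em i) => _; split; last by rewrite Gsum.
  by rewrite MhE; exists c.
have sX x : x \in s -> Xh x by move=> /qP[_ <-].
pose z w := \sum_(x <- s) b w (q_ x) *: x.
have zX w : Xh (z w) by exact: Xhsum.
have zb w m : Mh m -> b (z w) m = b w m.
  move=> Mm; rewrite -GE//.
  pose m' := \sum_(x <- s) ip (G m) x *: q_ x.
  have Mm' : Mh m' by apply: Mhsum => x /qP[].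
  have Gm' : G m' = G m.
    rewrite Gsum [RHS](Gs _ (spanG _ Mm)) [LHS]big_seq [RHS]big_seq.
    by apply: eq_bigr => x /qP[_ ->].
  have mm' : m = m'.
    apply/eqP; rewrite -subr_eq0 -normr_le0 -(pmulr_rle0 _ beta0).
    have MB : Mh (m - m') by rewrite addrC -scaleN1r; exact: MhD.
    apply: (le_trans (Gbelow _ MB)); rewrite normr_le0; apply/eqP.
    rewrite /G; under eq_bigr do rewrite bBr scalerBl.
    by rewrite sumrB -/(G m) -/(G m') Gm' subrr.
  rewrite {2}mm' b_sumZr (ipC ipP) ip_sumZl//; apply: eq_bigr => x _.
  by rewrite mulrC (ipC ipP).
have znorm w : `|z w| <= Cb / beta * `|w|.
  pose qz := \sum_(x <- s) b w (q_ x) *: q_ x.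
  have Mqz : Mh qz by apply: Mhsum => x /qP[].
  have Gqz : G qz = z w.
    by rewrite Gsum [LHS]big_seq [RHS]big_seq; apply: eq_bigr => x /qP[_ ->].
  have [->|z0] := eqVneq (z w) 0; first by rewrite normr0 mulr_ge0// divr_ge0// ltW.
  have nz : 0 < `|z w| by rewrite normr_gt0.
  have E : `|z w| ^+ 2 = b w qz by rewrite -(ipxx ipP) -{1}Gqz GE// zb.
  have qzle : `|qz| <= beta^-1 * `|z w| by rewrite ler_pdivlMl// -Gqz Gbelow.
  rewrite -(ler_pM2r nz) -expr2 E (le_trans (ler_norm _))// (le_trans (b_bounded _ _))//.
  have -> : Cb / beta * `|w| * `|z w| = Cb * `|w| * (beta^-1 * `|z w|) by ring.
  by rewrite ler_wpM2l// mulr_ge0.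
have zlin a w w' : z (a *: w + w') = a *: z w + z w'.
  rewrite /z scaler_sumr -big_split/=; apply: eq_bigr => t _.
  by rewrite scalerA -scalerDl bl.
exists (fun v => Q v + z (v - Q v)); split.
- move=> a x y; rewrite Qlin.
  have -> : a *: x + y - (a *: Q x + Q y) = a *: (x - Q x) + (y - Q y).
    by rewrite scalerBr opprD addrACA.
  by rewrite zlin [in RHS]scalerDr [RHS]addrACA.
- by move=> v; rewrite -(scale1r (Q v)); exact: XhD.
- move=> v m Mm; rewrite -{1}(scale1r (Q v)) bl mul1r zb// bBl.
  by rewrite addrCA subrr addr0.
move=> v; apply: le_dist_to => //; first by rewrite addr_ge0// divr_ge0// ltW.
move=> y Xy; rewrite opprD addrA (le_trans (ler_normB _ _))// mulrDl mul1r.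
have vy := Qbest v y Xy.
by rewrite lerD// (le_trans (znorm _))// ler_wpM2l// divr_ge0// ltW.
Qed.

End fortin.

(** * Bounded linear maps and integrals over bounded intervals *)

Section continuity.
Context {R : realType}.

Lemma additive_bounded_continuous (E F : normedModType R) (f : E -> F) (C : R) :
  (forall x y, f (x - y) = f x - f y) -> (forall x, `|f x| <= C * `|x|) -> continuous f.
Proof.
move=> fB fC x; apply/cvgrPdist_le => e e0.
have C1 : 0 < `|C| + 1 by rewrite ltr_wpDl.
have d0 : 0 < e / (`|C| + 1) by rewrite divr_gt0.
apply/nbhs_ballP; exists (e / (`|C| + 1)) => //= y; rewrite -ball_normE/= => /ltW xy.
rewrite -fB (le_trans (fC _))//.
apply: (@le_trans _ _ ((`|C| + 1) * `|x - y|)).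
  by rewrite ler_wpM2r// (le_trans (ler_norm _))// lerDl.
by rewrite mulrC -ler_pdivlMr.
Qed.

Lemma bounded_functional (E : normedModType R) (f : E -> R) (C : R) :
  (forall a x y, f (a *: x + y) = a * f x + f y) -> (forall x, `|f x| <= C * `|x|) ->
  exists l : dual E, forall x, l x = f x.
Proof.
move=> fl fC.
have fB x y : f (x - y) = f x - f y by rewrite addrC -scaleN1r fl mulN1r addrC.
have lf : (f : E -> R^o) \in @dual_pred R E.
  apply/asboolP; split; first exact: fl.
  exact: (@additive_bounded_continuous E R^o f C fB fC).
by exists (Dual lf).
Qed.

Lemma continuous_linear_bounded (E F : normedModType R) (f : {linear E -> F}) :
  continuous f -> exists2 C : R, 0 <= C & forall x, `|f x| <= C * `|x|.
Proof.
move=> cf; have /linear_boundedP : bounded_near f (nbhs (0 : E)).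
  exact/linear_bounded_continuous.
by move=> /pinfty_ex_gt0[C C0 fC]; exists C => //; exact: ltW.
Qed.

Lemma eval_dual_continuous (E : normedModType R) (x : E) :
  continuous (fun l : dual E => l x : R).
Proof.
apply: (@additive_bounded_continuous _ _ (fun l : dual E => l x : R) `|x|) => //.
by move=> l; rewrite mulrC; exact: le_dual_norm.
Qed.

Lemma continuous_linear_dual_bounded (E F : normedModType R) (f : {linear E -> dual F}) :
  continuous f -> exists2 C : R, 0 <= C & forall x y, `|f x y| <= C * `|x| * `|y|.
Proof.
move=> /continuous_linear_bounded[C C0 fC]; exists C => // x y.
by rewrite (le_trans (le_dual_norm _ _))// ler_wpM2r//; exact: fC.
Qed.

Lemma dist_to_continuous (E : normedModType R) (S : set E) : S !=set0 ->
  continuous (dist_to S : E -> R).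
Proof.
move=> [z0 Sz0].
have dle x y : dist_to S x - dist_to S y <= `|x - y|.
  rewrite lerBlDr -lerBlDl; apply: lb_le_inf; first by exists `|y - z0|, z0.
  move=> _ [z Sz <-]; rewrite lerBlDl; apply: (le_trans (dist_to_le x Sz)).
  exact: ler_distD.
move=> x; apply/cvgrPdist_le => e e0.
apply/nbhs_ballP; exists e => //= y; rewrite -ball_normE/= => /ltW.
apply: le_trans; rewrite ler_norml dle andbT lerNl opprB distrC.
exact: dle.
Qed.

Lemma within_continuous_comp (E F : normedModType R) (D : set R) (f : R -> E) (g : E -> F) :
  {within D, continuous f} -> continuous g -> {within D, continuous (g \o f)}.
Proof.
move=> /subspace_continuousP cf cg; apply/subspace_continuousP => t Dt.
exact: (cvg_comp _ _ (cf _ Dt) (cg (f t))).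
Qed.

Lemma within_continuousB (D : set R) (f g : R -> R) :
  {within D, continuous f} -> {within D, continuous g} ->
  {within D, continuous (fun t => f t - g t)}.
Proof.
move=> /subspace_continuousP cf /subspace_continuousP cg.
by apply/subspace_continuousP => t Dt; apply: cvgB; [exact: cf|exact: cg].
Qed.

Lemma is_derive_additive_comp (E F : normedModType R) (f : R -> E) (g : E -> F) t df :
  (forall a x y, g (a *: x + y) = a *: g x + g y) -> continuous g ->
  is_derive t (1 : R) f df -> is_derive t (1 : R) (g \o f) (g df).
Proof.
move=> gl cg [dft fdf].
have gB x y : g (x - y) = g x - g y by rewrite addrC -scaleN1r gl scaleN1r addrC.
have g0 : g 0 = 0 by rewrite -(subrr 0) gB subrr.
have gZ a x : g (a *: x) = a *: g x by have := gl a x 0; rewrite addr0 g0 addr0.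
have H : (fun h : R => h^-1 *: ((g \o f) (h *: (1:R) + t) - (g \o f) t)) @ 0^' --> g df.
  have -> : (fun h : R => h^-1 *: ((g \o f) (h *: (1:R) + t) - (g \o f) t)) =
      g \o (fun h : R => h^-1 *: (f (h *: (1:R) + t) - f t)).
    by apply/funext => h /=; rewrite gZ gB.
  have fl : (fun h : R => h^-1 *: (f (h *: (1:R) + t) - f t)) @ 0^' --> df.
    by rewrite -fdf; exact: dft.
  exact: (cvg_comp _ _ fl (cg df)).
by apply: DeriveDef; [apply/cvg_ex; exists (g df)|exact/cvg_lim].
Qed.

End continuity.

Section integrals.
Context {R : realType}.
Notation mu := (@lebesgue_measure R).

Lemma mu_itv_oo (a b : R) : a <= b -> mu `]a, b[ = (b - a)%:E.
Proof.
rewrite lebesgue_measure_itv/= lte_fin le_eqVlt => /predU1P[->|->]; last by rewrite EFinB.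
by rewrite ltxx subrr.
Qed.

Lemma mu_itv_oo_lty (a b : R) : (mu `]a, b[ < +oo)%E.
Proof. by rewrite lebesgue_measure_itv/=; case: ifPn => // _; rewrite -EFinB ltry. Qed.

Lemma integrable_cst_oo (a b c : R) : mu.-integrable `]a, b[ (EFin \o cst c).
Proof.
apply: within_continuous_integrable_oo; apply: continuous_subspaceT.
exact: cst_continuous.
Qed.

Lemma Rintegral_cst_oo (a b c : R) : a <= b -> \int[mu]_(t in `]a, b[) c = c * (b - a).
Proof.
by move=> ab; rewrite Rintegral_cst// -[b - a in RHS]/(fine (b - a)%:E) -mu_itv_oo.
Qed.

(** [|g| <= 1 + g^2], and the interval has finite measure. *)
Lemma square_integrable (a b : R) (g : R -> R) : measurable_fun `]a, b[ g ->
  (\int[mu]_(t in `]a, b[) (g t ^+ 2)%:E < +oo)%E ->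
  mu.-integrable `]a, b[ (EFin \o g) /\
  mu.-integrable `]a, b[ (EFin \o (fun t => g t ^+ 2)).
Proof.
move=> mg g2.
have i2 : mu.-integrable `]a, b[ (EFin \o (fun t => g t ^+ 2)).
  apply/integrableP; split; first by apply/measurable_EFinP; exact: measurable_funX.
  by under eq_integral do rewrite /= ger0_norm ?sqr_ge0//.
split => //; have i1 := integrable_cst_oo a b 1.
have i12 : mu.-integrable `]a, b[ (EFin \o (fun t => 1 + g t ^+ 2)).
  have -> : EFin \o (fun t => 1 + g t ^+ 2) =
      (EFin \o cst 1) \+ (EFin \o (fun t => g t ^+ 2)) by apply/funext.
  exact: integrableD.
apply: (@le_integrable _ _ R mu _ (measurable_itv _) _ _ _ _ i12); first exact/measurable_EFinP.
move=> t _; rewrite /= lee_fin [leRHS]ger0_norm ?addr_ge0 ?sqr_ge0//.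
rewrite -(real_normK (num_real (g t))); have := normr_ge0 (g t); nra.
Qed.

(** Cauchy-Schwarz: with [m] the mean of [g], integrate
    [2 m g <= g^2 + m^2]. *)
Lemma sqr_Rintegral_le (a b : R) (g : R -> R) : a < b ->
  mu.-integrable `]a, b[ (EFin \o g) ->
  mu.-integrable `]a, b[ (EFin \o (fun t => g t ^+ 2)) ->
  (\int[mu]_(t in `]a, b[) g t) ^+ 2 <= (b - a) * \int[mu]_(t in `]a, b[) (g t ^+ 2).
Proof.
move=> ab ig ig2; set I := \int[mu]_(t in _) g t; set J := \int[mu]_(t in _) _.
have ba : 0 < b - a by rewrite subr_gt0.
pose m := I / (b - a).
have ic c := integrable_cst_oo a b c.
have H : \int[mu]_(t in `]a, b[) (2 * m * g t) <= \int[mu]_(t in `]a, b[) (g t ^+ 2 + m ^+ 2).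
  apply: le_Rintegral => //.
  - exact: (@integrableZl _ _ R mu _ _ (2 * m) _ ig).
  - exact: integrableD ig2 (ic _).
  - by move=> t _; have := sqr_ge0 (g t - m); nra.
move: H; rewrite RintegralZl// RintegralD//; last exact: ic.
rewrite (Rintegral_cst_oo _ (ltW ab)) -/I -/J => H.
have mI : m * (b - a) = I by rewrite /m divfK// gt_eqF.
have mIJ : m * I <= J.
  have E : m ^+ 2 * (b - a) = m * I by rewrite expr2 -mulrA mI.
  by move: H; rewrite E -mulrA; lra.
have -> : I ^+ 2 = (b - a) * (m * I) by rewrite mulrA (mulrC _ m) mI expr2.
by rewrite ler_wpM2l// ltW.
Qed.

End integrals.

(** * Weak Taylor formula and discrete Gronwall inequality *)

Section weak_derivatives.
Context {R : realType}.
Notation mu := (@lebesgue_measure R).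

(** Apply [l] to the two Bochner integrals in the definition of the vector-valued
    weak derivative.  The representatives [u'] and [du'] make the scalar integrands
    Borel. *)
Lemma weak_derivative_dual (E : normedModType R) (T : R) (u u' du du' : R -> E)
    (Nu Nd : set R) (l : dual E) :
  measurable Nu -> mu Nu = 0%E -> (forall t, `]0, T[%classic t -> ~ Nu t -> u' t = u t) ->
  measurable Nd -> mu Nd = 0%E -> (forall t, `]0, T[%classic t -> ~ Nd t -> du' t = du t) ->
  measurable_fun `]0, T[ (l \o u' : R -> R) -> measurable_fun `]0, T[ (l \o du' : R -> R) ->
  weak_derivative T u du -> scalar_weak_derivative T (l \o u') (l \o du').
Proof.
move=> mNu Nu0 u'E mNd Nd0 du'E mlu mldu wd th tht.
have [I [I1 I2]] := wd th tht.
have D0 := mu_itv_oo_lty 0 T.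
have mth : measurable_fun `]0, T[ th.
  apply: measurable_funTS; apply: continuous_measurable_fun.
  exact: test_function_continuous tht.
have mdth : measurable_fun `]0, T[ (derive1 th).
  apply: measurable_funTS; apply: continuous_measurable_fun.
  exact: test_function_continuous (test_function_derive1 tht).
have [_ ->] := @bochner_integral_dual R E `]0, T[ Nu _ I l (fun t => derive1 th t * l (u' t))
  (measurable_itv _) D0 mNu Nu0 (measurable_funM mdth mlu)
  (fun t Dt Nt => etrans (congr1 (fun x => derive1 th t * l x) (u'E t Dt Nt)) (esym (dualZ l _ _))) I1.
have [_ ->] := @bochner_integral_dual R E `]0, T[ Nd _ (- I) l (fun t => th t * l (du' t))
  (measurable_itv _) D0 mNd Nd0 (measurable_funM mth mldu)
  (fun t Dt Nt => etrans (congr1 (fun x => th t * l x) (du'E t Dt Nt)) (esym (dualZ l _ _))) I2.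
by rewrite dualN opprK.
Qed.

Lemma integrable_sub_oo (a b c d : R) (g : R -> R) : a <= c -> d <= b ->
  mu.-integrable `]a, b[ (EFin \o g) -> mu.-integrable `]c, d[ (EFin \o g).
Proof.
move=> ac db; apply: integrableS => //; apply: subset_itvW => //.
Qed.

Lemma Rintegral_oo_split (a b c : R) (g : R -> R) : a <= b -> b <= c ->
  mu.-integrable `]a, c[ (EFin \o g) ->
  \int[mu]_(t in `]a, c[) g t = \int[mu]_(t in `]a, b[) g t + \int[mu]_(t in `]b, c[) g t.
Proof.
move=> ab; rewrite le_eqVlt => /predU1P[<-|bc] ig.
  by rewrite set_itvoo0 Rintegral_set0 addr0.
apply/eqP; rewrite addrC -subr_eq; apply/eqP.
rewrite [X in _ - X]Rintegral_itv_bndo_bndc; last first.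
  by apply: integrable_sub_oo ig => //; exact: ltW.
by rewrite Rintegral_itvB.
Qed.

Lemma Rintegral_oo_le (a b c d : R) (g : R -> R) : a <= c -> c <= d -> d <= b ->
  (forall t, 0 <= g t) -> mu.-integrable `]a, b[ (EFin \o g) ->
  \int[mu]_(t in `]c, d[) g t <= \int[mu]_(t in `]a, b[) g t.
Proof.
move=> ac cd db g0 ig; have ad := le_trans ac cd.
rewrite (Rintegral_oo_split ad db ig) (Rintegral_oo_split ac cd (integrable_sub_oo (lexx a) db ig)).
have H x y : 0 <= \int[mu]_(t in `]x, y[) g t by exact: Rintegral_ge0.
by rewrite -addrA addrCA lerDl addr_ge0.
Qed.

Lemma Rintegral_grid (g : R -> R) (dt T : R) (N : nat) : 0 <= dt -> N%:R * dt <= T ->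
  mu.-integrable `]0, T[ (EFin \o g) ->
  \sum_(1 <= n < N.+1) \int[mu]_(t in `](n.-1)%:R * dt, n%:R * dt[) g t =
  \int[mu]_(t in `]0, N%:R * dt[) g t.
Proof.
move=> dt0; elim: N => [|N ih] NT ig.
  by rewrite big_geq// mul0r set_itvoo0 Rintegral_set0.
have NN : N%:R * dt <= N.+1%:R * dt by rewrite ler_wpM2r// ler_nat.
rewrite big_nat_recr//= ih//; last exact: le_trans NN NT.
rewrite [RHS](@Rintegral_oo_split _ (N%:R * dt))//; first by rewrite mulr_ge0.
exact: integrable_sub_oo ig.
Qed.

(** [phi t - phi s] is the integral of [Phi] by [weak_ftc], and
    [Phi x - Phi t] is in turn bounded in absolute value by the integral of
    [|w|] over [[s, t]]. *)
Lemma weak_taylor_le (T s t : R) (phi Phi w : R -> R) :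
  {within `[0, T], continuous phi} -> {within `[0, T], continuous Phi} ->
  mu.-integrable `]0, T[ (EFin \o w) ->
  scalar_weak_derivative T phi Phi -> scalar_weak_derivative T Phi w ->
  0 <= s -> s <= t -> t <= T ->
  `|phi t - phi s - (t - s) * Phi t| <= (t - s) * \int[mu]_(x in `]s, t[) `|w x|.
Proof.
move=> cphi cPhi iw wphi wPhi s0 st tT.
have iPhi := within_continuous_integrable_oo cPhi.
have iaw : mu.-integrable `]0, T[ (EFin \o (fun x => `|w x|)) by exact: integrable_norm iw.
rewrite (weak_ftc cphi iPhi wphi s0 st tT).
rewrite (mulrC (t - s)) -Rintegral_cst_oo// -RintegralB//; last 2 first.
- exact: integrable_sub_oo iPhi.
- exact: integrable_cst_oo.
have id : mu.-integrable `]s, t[ (EFin \o (fun x => Phi x - Phi t)).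
  have -> : EFin \o (fun x => Phi x - Phi t) = ((EFin \o Phi) \- (EFin \o cst (Phi t)))%E.
    by apply/funext => x; rewrite /= EFinB.
  by apply: integrableB => //; [exact: integrable_sub_oo iPhi|exact: integrable_cst_oo].
apply: (le_trans (le_normr_Rintegral _ id)) => //.
rewrite (mulrC (t - s)) -Rintegral_cst_oo//; apply: le_Rintegral => //.
- exact: integrable_norm id.
- exact: integrable_cst_oo.
move=> x; rewrite /= in_itv/= => /andP[sx xt].
have x0 : 0 <= x by rewrite (le_trans s0)// ltW.
rewrite distrC (weak_ftc cPhi iw wPhi x0 (ltW xt) tT).
apply: (le_trans (le_normr_Rintegral _ _)) => //; first exact: integrable_sub_oo iw.
apply: Rintegral_oo_le => //; [exact: ltW|exact: ltW|].
exact: integrable_sub_oo iaw.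
Qed.

(** A nonzero value of [h] would, by continuity, persist on an interval of
    positive measure. *)
Lemma ae_eq_continuous (T : R) (h : R -> R) : 0 < T ->
  {within `[0, T], continuous h} ->
  {ae mu, forall t, t \in `]0, T[ -> h t = 0} -> forall t, 0 <= t <= T -> h t = 0.
Proof.
move=> T0 ch [N [mN N0 hN]] t tT; apply: contrapT => /eqP ht.
have e0 : 0 < `|h t| by rewrite normr_gt0.
have /subspace_continuousP/(_ t) := ch; rewrite /= in_itv/= => /(_ tT).
move=> /cvgrPdist_lt/(_ _ e0) H.
have /nbhs_ballP[d /= d0 td] :
  \forall x \near t, [set` `[0, T]] x -> `|h t - h x| < `|h t| := H.
pose a := Num.max 0 (t - d); pose c := Num.min T (t + d).
have ac : a < c.
  by move: tT => /andP[? ?]; rewrite /a /c gt_max !lt_min; apply/andP; split; apply/andP; split; lra.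
have acN : `]a, c[ `<=` N.
  move=> x; rewrite /= in_itv/= /a /c gt_max lt_min => /andP[/andP[x0 xd] /andP[xT dx]].
  apply: hN => /= /(_ _); rewrite in_itv/= x0 xT => /(_ isT) hx.
  have : `|h t - h x| < `|h t|.
    apply: td; last by rewrite /= in_itv/= !ltW.
    by rewrite /ball/= ltr_norml; lra.
  by rewrite hx subr0 ltxx.
have : (mu `]a, c[ <= mu N)%E by apply: le_measure => //; exact: mem_set.
rewrite N0 (mu_itv_oo (ltW ac)) lee_fin; lra.
Qed.

End weak_derivatives.

Section discrete_gronwall.
Context {R : realType}.

Lemma sum_le_grow (N n : nat) (K : nat -> R) : (n <= N)%N -> (forall i, 0 <= K i) ->
  \sum_(1 <= i < n.+1) K i <= \sum_(1 <= i < N.+1) K i.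
Proof.
by move=> nN K0; rewrite [leRHS](@big_cat_nat _ _ _ n.+1)//= ?lerDl ?sumr_ge0.
Qed.

(** Absorbing [2 xi dt r n] on the left multiplies the recursion by
    [(1 - 2 xi dt)^-1 <= 1 + 4 xi dt], since [4 xi dt <= 1].  Iterating
    [N] times costs at most [expR (4 xi N dt)].  Summing the recursion with this
    bound on [r n] then controls the dissipation terms [a n]. *)
Lemma discrete_gronwall (N : nat) (r a K : nat -> R) (xi dt al : R) :
  0 <= xi -> 0 < dt -> 4 * xi * dt <= 1 -> 0 <= al ->
  (forall n, 0 <= r n) -> (forall n, 0 <= a n) -> (forall n, 0 <= K n) ->
  (forall n, (1 <= n <= N)%N ->
     r n - r n.-1 + dt * al * a n <= 2 * xi * dt * r n + dt * K n) ->
  let G := expR (4 * xi * (N%:R * dt)) in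
  let F := r 0%N + dt * \sum_(1 <= i < N.+1) K i in
  (forall n, (n <= N)%N -> r n <= G * F) /\
  dt * al * \sum_(1 <= i < N.+1) a i <= (1 + 2 * xi * (N%:R * dt) * G) * F.
Proof.
move=> xi0 dt0 xidt al0 r0 a0 K0 step G F.
pose q := 1 + 4 * xi * dt.
have x0 : 0 <= xi * dt by rewrite mulr_ge0// ltW.
have q1 : 1 <= q by rewrite /q; nra.
have step1 n : (1 <= n <= N)%N -> r n <= q * (r n.-1 + dt * K n).
  move=> nN; have := step n nN; have := r0 n; have := r0 n.-1.
  have dK : 0 <= dt * K n by rewrite mulr_ge0// ltW.
  have aa : 0 <= dt * al * a n by rewrite !mulr_ge0// ltW.
  move=> rn1 rn H; have {}H : (1 - 2 * (xi * dt)) * r n <= r n.-1 + dt * K n by lra.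
  have q0 : 0 <= q by rewrite (le_trans _ q1).
  apply: (le_trans _ (ler_wpM2l q0 H)).
  rewrite [leRHS]mulrA ler_peMl// /q.
  set y := xi * dt in x0 *; have y4 : 4 * y <= 1 by rewrite /y mulrA.
  by rewrite -(mulrA 4) -/y; nra.
have rq n : (n <= N)%N -> r n <= q ^+ n * (r 0%N + dt * \sum_(1 <= i < n.+1) K i).
  elim: n => [|n ih] nN; first by rewrite big_geq// mulr0 addr0 expr0 mul1r.
  have {}ih := ih (ltnW nN).
  apply: (le_trans (step1 n.+1 _)); first by rewrite nN.
  rewrite exprS -mulrA ler_wpM2l//; first by rewrite (le_trans _ q1).
  rewrite big_nat_recr//= [dt * (_ + _)]mulrDr addrA [leRHS]mulrDr lerD//.
  by rewrite ler_peMl ?exprn_ege1// mulr_ge0// ltW.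
have F0 : 0 <= F by rewrite addr_ge0// mulr_ge0 ?(ltW dt0)// sumr_ge0.
have qG n : (n <= N)%N -> q ^+ n <= G.
  move=> nN; apply: (@le_trans _ _ (q ^+ N)); first by rewrite ler_weXn2l.
  rewrite /G (_ : 4 * xi * (N%:R * dt) = N%:R * (4 * xi * dt)); last by ring.
  rewrite expRM_natl lerXn2r ?nnegrE ?expR_ge0//; first by rewrite (le_trans _ q1).
  exact: expR_ge1Dx.
have rG n : (n <= N)%N -> r n <= G * F.
  move=> nN; apply: (le_trans (rq n nN)).
  apply: (@le_trans _ _ (q ^+ n * F)).
    rewrite ler_wpM2l ?exprn_ge0//; first by rewrite (le_trans _ q1).
    by rewrite lerD2l ler_wpM2l ?(ltW dt0)// sum_le_grow.
  by rewrite ler_wpM2r// qG.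
split=> //.
have S : \sum_(1 <= n < N.+1) (r n - r n.-1 + dt * al * a n) <=
    \sum_(1 <= n < N.+1) (2 * xi * dt * (G * F) + dt * K n).
  rewrite big_nat_cond [leRHS]big_nat_cond; apply: ler_sum => n /andP[nN _].
  apply: (le_trans (step n _)); first by rewrite -ltnS.
  rewrite lerD2r ler_wpM2l//; first by rewrite !mulr_ge0// ltW.
  by apply: rG; case/andP: nN.
move: S; rewrite [leLHS]big_split [leRHS]big_split/= -!mulr_sumr sumr_const_nat subn1/=.
have -> : \sum_(1 <= n < N.+1) (r n - r n.-1) = r N - r 0%N.
  elim: (N) => [|n ih]; first by rewrite big_geq// subrr.
  by rewrite big_nat_recr//= ih; ring.
have := r0 N; rewrite -[F *+ N]mulr_natl => rN0 H.
have -> : (1 + 2 * xi * (N%:R * dt) * G) * F = F + 2 * xi * dt * (G * (N%:R * F)) by ring.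
have FE : F = r 0%N + dt * \sum_(1 <= i < N.+1) K i by [].
by clearbody F; lra.
Qed.

End discrete_gronwall.

(** * From the energy recursion to the error bound *)

Section energy.
Context {R : realType}.

(** Young's inequality with weight [al] absorbs half of the coercive term:
    [t B <= al t^2 / 2 + B^2 / (2 al)].  Here [p], [q] are the energies at two
    successive times, [c] their mixed term and [t] the norm of the test vector. *)
Lemma energy_step (p q c a al xi dt B t : R) : 0 < dt -> 0 < al ->
  2 * c <= p + q -> dt^-1 * (p - c) + a <= t * B -> al * t ^+ 2 <= a + xi * p ->
  p - q + dt * al * t ^+ 2 <= 2 * xi * dt * p + dt * (B ^+ 2 / al).
Proof.
move=> dt0 al0 c2 H1 H2.
have H3 : t * B <= al / 2 * t ^+ 2 + B ^+ 2 / al / 2.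
  rewrite -subr_ge0.
  have -> : al / 2 * t ^+ 2 + B ^+ 2 / al / 2 - t * B = (al * t - B) ^+ 2 / (2 * al).
    by field; rewrite gt_eqF.
  by rewrite divr_ge0 ?sqr_ge0// mulr_ge0// ltW.
have H4 : dt^-1 * (p - c) + al / 2 * t ^+ 2 <= xi * p + B ^+ 2 / al / 2 by lra.
have := ler_wpM2l (ltW dt0) H4.
rewrite mulrDr mulVKf ?gt_eqF// => H5.
move: H5; set K := B ^+ 2 / al; set t2 := t ^+ 2; lra.
Qed.

Lemma sqr_sum4_le (x y z w : R) :
  (x + y + z + w) ^+ 2 <= 4 * (x ^+ 2 + y ^+ 2 + z ^+ 2 + w ^+ 2).
Proof.
rewrite -subr_ge0.
have -> : 4 * (x ^+ 2 + y ^+ 2 + z ^+ 2 + w ^+ 2) - (x + y + z + w) ^+ 2 =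
  (x - y) ^+ 2 + (x - z) ^+ 2 + (x - w) ^+ 2 + (y - z) ^+ 2 + (y - w) ^+ 2 + (z - w) ^+ 2 by ring.
by rewrite !addr_ge0// sqr_ge0.
Qed.

Lemma weighted_sum4_le (p q r s x y z w : R) :
  0 <= p -> 0 <= q -> 0 <= r -> 0 <= s -> 0 <= x -> 0 <= y -> 0 <= z -> 0 <= w ->
  p * x + q * y + r * z + s * w <= (p + q + r + s) * (x + y + z + w).
Proof.
move=> p0 q0 r0 s0 x0 y0 z0 w0; rewrite -subr_ge0.
have -> : (p + q + r + s) * (x + y + z + w) - (p * x + q * y + r * z + s * w) =
  p * (y + z + w) + q * (x + z + w) + r * (x + y + w) + s * (x + y + z) by ring.
by rewrite !(addr_ge0, mulr_ge0).
Qed.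

(** The real arithmetic behind the estimate.  The sequences [del], [d], [rho] and [D]
    stand for the step integrals of [|d_tt u|], the distance from
    [d_t lambda (t_n)] to [M_h], the step integrals of the distance from [d_t u] to [X_h],
    and the distance from [u (t_n)] to [X_h]; [S0], [Sm], [S1], [S2], [S3] are
    the five terms of the right-hand side.  The weight [dt^-1] of [rho] is
    balanced by Cauchy-Schwarz on each step, which turns its squares into
    [dt S1]. *)
Lemma error_bound_of_step (N : nat) (r a B del d rho D : nat -> R)
    (dt T al xi c cr S0 Sm S1 S2 S3 : R) :
  0 < dt -> N%:R * dt = T -> 0 < al -> 0 <= xi -> 4 * xi * dt <= 1 -> 0 <= c -> 0 <= cr ->
  0 <= S0 -> 0 <= Sm -> 0 <= S1 -> 0 <= S2 -> 0 <= S3 ->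
  (forall n, 0 <= r n) -> (forall n, 0 <= a n) ->
  (forall n, 0 <= B n) ->
  (forall n, (1 <= n <= N)%N -> B n <= c * (del n + d n + dt^-1 * rho n + D n)) ->
  (forall n, (1 <= n <= N)%N ->
     r n - r n.-1 + dt * al * a n <= 2 * xi * dt * r n + dt * (B n ^+ 2 / al)) ->
  dt * \sum_(1 <= n < N.+1) del n ^+ 2 <= S2 ->
  dt * \sum_(1 <= n < N.+1) d n ^+ 2 <= S3 ->
  \sum_(1 <= n < N.+1) rho n ^+ 2 <= dt * S1 ->
  (forall n, (n <= N)%N -> D n ^+ 2 <= Sm) ->
  r 0%N <= cr * (S0 + Sm) ->
  let CF := cr + 4 * c ^+ 2 / al * (1 + T) in
  let S := S0 + Sm + S1 + S2 + S3 in
  (forall n, (n <= N)%N -> r n <= expR (4 * xi * T) * (CF * S)) /\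
  dt * \sum_(1 <= n < N.+1) a n <= (1 + 2 * xi * T * expR (4 * xi * T)) / al * (CF * S).
Proof.
move=> dt0 NT al0 xi0 xidt c0 cr0 S00 Sm0 S10 S20 S30 r0 a0 B0 Bc step Sdel Sd Srho SD r0S CF S.
have T0 : 0 <= T by rewrite -NT mulr_ge0// ltW.
pose K n := B n ^+ 2 / al.
have K0 n : 0 <= K n by rewrite divr_ge0 ?sqr_ge0// ltW.
have [rG aG] := discrete_gronwall xi0 dt0 xidt (ltW al0) r0 a0 K0 step.
have FS : r 0%N + dt * \sum_(1 <= i < N.+1) K i <= CF * S.
  have cal : 0 <= 4 * c ^+ 2 / al by rewrite divr_ge0 ?(ltW al0)// mulr_ge0// sqr_ge0.
  have SK : dt * \sum_(1 <= i < N.+1) K i <= 4 * c ^+ 2 / al * (S2 + S3 + S1 + T * Sm).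
    have KS : \sum_(1 <= i < N.+1) K i <= 4 * c ^+ 2 / al *
        \sum_(1 <= i < N.+1) (del i ^+ 2 + d i ^+ 2 + dt^-1 ^+ 2 * rho i ^+ 2 + Sm).
      rewrite mulr_sumr big_nat_cond [leRHS]big_nat_cond; apply: ler_sum => i /andP[iN _].
      have {}iN : (1 <= i <= N)%N by rewrite -ltnS.
      rewrite /K [leRHS]mulrAC ler_wpM2r ?invr_ge0 ?(ltW al0)//.
      apply: (@le_trans _ _ ((c * (del i + d i + dt^-1 * rho i + D i)) ^+ 2)).
        by rewrite ler_sqr ?nnegrE ?Bc// (le_trans (B0 i))// Bc.
      rewrite exprMn [X in _ <= X](_ : _ = c ^+ 2 * (4 * (del i ^+ 2 + d i ^+ 2 + dt^-1 ^+ 2 * rho i ^+ 2 + Sm))); last by ring.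
      rewrite ler_wpM2l ?sqr_ge0//.
      apply: (le_trans (sqr_sum4_le _ _ _ _)); rewrite ler_wpM2l// exprMn lerD2l.
      by apply: SD; case/andP: iN.
    apply: (le_trans (ler_wpM2l (ltW dt0) KS)); rewrite mulrCA ler_wpM2l//.
    rewrite !big_split/= -mulr_sumr sumr_const_nat subn1/= !mulrDr.
    have -> : dt * (Sm *+ N) = T * Sm by rewrite -NT -[Sm *+ N]mulr_natl; ring.
    rewrite !lerD// mulrA.
    have -> : dt * dt^-1 ^+ 2 = dt^-1 by field; rewrite gt_eqF.
    by rewrite ler_pdivrMl.
  have S4 : 4 * c ^+ 2 / al * (S2 + S3 + S1 + T * Sm) <= 4 * c ^+ 2 / al * ((1 + T) * S).
    rewrite ler_wpM2l// /S; nra.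
  have S5 : cr * (S0 + Sm) <= cr * S by rewrite ler_wpM2l// /S; lra.
  rewrite /CF mulrDl -(mulrA (_ / al)); lra.
rewrite NT in rG aG; have G0 := expR_ge0 (4 * xi * T).
split=> [n nN|].
  by apply: (le_trans (rG n nN)); rewrite ler_wpM2l.
rewrite mulrAC ler_pdivlMr//.
rewrite mulrAC; apply: (le_trans aG); rewrite ler_wpM2l//.
by rewrite addr_ge0// !mulr_ge0.
Qed.

End energy.

Section solution.
Context {R : realType}.
Notation mu := (@lebesgue_measure R).

(** Passing to the Borel representative does not increase integrals of squares,
    which are lower integrals for the original function. *)
Lemma L2_representative (E : normedModType R) (T : R) (f : R -> E) : in_L2 T f ->
  exists (f' : R -> E) (N : set R), [/\ measurable N, mu N = 0%E,
    forall t, `]0, T[%classic t -> ~ N t -> f' t = f t,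
    forall g : E -> R, continuous g -> measurable_fun `]0, T[ (g \o f') &
    forall g : E -> R, continuous g ->
      (\int[mu]_(t in `]0%R, T[) (g (f' t) ^+ 2)%:E <=
       \int[mu]_(t in `]0%R, T[) (g (f t) ^+ 2)%:E)%E].
Proof.
move=> [sf _].
have [f' [N [mN N0 f'E mf']]] := strongly_measurable_representative (measurable_itv _) sf.
exists f', N; split => // g cg.
have mg := mf' g cg.
apply: (@null_le_lower_integral _ _ R mu _ N) => //.
- by apply/measurable_EFinP; apply: measurable_funX; exact: mg.
- by move=> t _; rewrite lee_fin sqr_ge0.
- by move=> t _; rewrite lee_fin sqr_ge0.
- by move=> t Dt Nt; rewrite f'E.
Qed.

Lemma dual_integrable (E : normedModType R) (T : R) (f : R -> E) (l : dual E) :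
  measurable_fun `]0, T[ (l \o f : R -> R) ->
  mu.-integrable `]0, T[ (EFin \o (fun t => `|f t|)) ->
  mu.-integrable `]0, T[ (EFin \o (l \o f : R -> R)).
Proof.
move=> mlf iF; have [C C0 lC] := dual_bounded l.
have iC : mu.-integrable `]0, T[ (EFin \o (fun t => C * `|f t|)).
  exact: (@integrableZl _ _ R mu _ (measurable_itv _) C _ iF).
apply: (@le_integrable _ _ R mu _ (measurable_itv _) _ _ _ _ iC).
  by apply/measurable_EFinP; exact: mlf.
by move=> t _; rewrite /= lee_fin [leRHS]ger0_norm// mulr_ge0.
Qed.

End solution.

(** * Consistency of the exact solution *)

Section solution_pairings.
Context {R : realType}.
Notation mu := (@lebesgue_measure R).

(** Since [lam] is continuously differentiable, the term [b v (lam t)] of the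
    distributional equation can be integrated by parts; what is left is a weak
    derivative of the pairing of [u] alone, and a continuous one. *)
Lemma pairing_weak_derivative (X Y M : completeNormedModType R) (T : R)
    (j : {linear X -> Y}) (Rop : Y -> dual Y) (Aop : {linear X -> dual X})
    (b : X -> M -> R) (u : R -> X) (lam dlam : R -> M) (f : R -> dual X) (v : X)
    (l : dual Y) (Cb : R) :
  0 < T -> continuous j -> continuous Aop ->
  (forall a m n, b v (a *: m + n) = a * b v m + b v n) ->
  (forall m, `|b v m| <= Cb * `|m|) ->
  (forall y, l y = Rop y (j v)) ->
  {within `[0, T], continuous u} -> {within `[0, T], continuous f} ->
  in_C1 T lam dlam ->
  distributional_ode T (fun t => Rop (j (u t)) (j v) + b v (lam t))
    (fun t => Aop (u t) v) (fun t => f t v) ->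
  {within `[0, T], continuous (fun t => f t v - Aop (u t) v - b v (dlam t))} /\
  scalar_weak_derivative T (fun t => l (j (u t)))
    (fun t => f t v - Aop (u t) v - b v (dlam t)).
Proof.
move=> T0 cj cA bl bC lE cu cf [clam cdlam dlamE] ode.
have bB x y : b v (x - y) = b v x - b v y by rewrite addrC -scaleN1r bl mulN1r addrC.
have cb : continuous (b v : M -> R) by exact: (@additive_bounded_continuous _ _ R^o _ Cb bB bC).
have cphi : {within `[0, T], continuous (fun t => l (j (u t)) : R)}.
  apply: (@within_continuous_comp _ _ R^o _ _ (fun x => l (j x)) cu) => x.
  exact: (cvg_comp _ _ (cj x) (@dual_is_continuous _ _ l (j x))).
have ca : {within `[0, T], continuous (fun t => Aop (u t) v : R)}.
  apply: (@within_continuous_comp _ _ R^o _ _ (fun x => Aop x v) cu) => x.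
  exact: (cvg_comp _ _ (cA x) (@eval_dual_continuous _ _ v (Aop x))).
have cfv : {within `[0, T], continuous (fun t => f t v : R)}.
  exact: (@within_continuous_comp _ _ R^o _ _ _ cf (@eval_dual_continuous _ _ v)).
have cbe : {within `[0, T], continuous (fun t => b v (lam t))}.
  exact: (@within_continuous_comp _ _ R^o _ _ _ clam cb).
have cdbe : {within `[0, T], continuous (fun t => b v (dlam t))}.
  exact: (@within_continuous_comp _ _ R^o _ _ _ cdlam cb).
have cPhi : {within `[0, T], continuous (fun t => f t v - Aop (u t) v - b v (dlam t))}.
  by apply: within_continuousB => //; exact: within_continuousB.
split => // th tht.
have cth : {within `[0, T], continuous th}.
  by apply: continuous_subspaceT; exact: test_function_continuous tht.
have cdth : {within `[0, T], continuous (derive1 th)}.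
  apply: continuous_subspaceT.
  exact: test_function_continuous (test_function_derive1 tht).
have ii (g h : R -> R) : {within `[0, T], continuous g} -> {within `[0, T], continuous h} ->
    mu.-integrable `]0, T[ (EFin \o (fun t => g t * h t)).
  by move=> cg ch; apply: within_continuous_integrable_oo; exact: within_continuousM.
have ibp := test_function_ibp T0 tht cbe cdbe
  (fun t tT => @is_derive_additive_comp _ _ R^o _ (b v) t _ bl cb (dlamE t tT)).
have := ode th tht; move: ibp.
set IB := \int[mu]_(t in _) (b v (lam t) * _); set IDB := \int[mu]_(t in _) (b v (dlam t) * _).
set IA := \int[mu]_(t in _) (Aop (u t) v * _); set IF := \int[mu]_(t in _) (f t v * _).
move=> ibp.
have -> : \int[mu]_(t in `]0, T[) ((Rop (j (u t)) (j v) + b v (lam t)) * derive1 th t) =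
    \int[mu]_(t in `]0, T[) (derive1 th t * l (j (u t))) + IB.
  rewrite -RintegralD//; [|exact: ii|exact: ii].
  by apply: eq_Rintegral => t _; rewrite -lE mulrDl (mulrC (l _)).
have -> : \int[mu]_(t in `]0, T[) (th t * (f t v - Aop (u t) v - b v (dlam t))) =
    IF - IA - IDB.
  have -> : IF - IA = \int[mu]_(t in `]0, T[) ((f t v - Aop (u t) v) * th t).
    rewrite -RintegralB//; [|exact: ii|exact: ii].
    by apply: eq_Rintegral => t _; ring.
  rewrite -RintegralB//; [|by apply: ii => //; exact: within_continuousB|exact: ii].
  by apply: eq_Rintegral => t _; ring.
by move=> H; lra.
Qed.

(** Backward Euler consistency error, tested with [v].  The weak derivative
    [Phi] of the pairing [<R u, v>] has itself the weak derivative
    [<R d_tt u, v>], so [weak_taylor_le] applies. *)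
Lemma solution_consistency (X Y M : completeNormedModType R) (T : R)
    (j : {linear X -> Y}) (Rop : {linear Y -> dual Y}) (Aop : {linear X -> dual X})
    (b : X -> M -> R) (u : R -> X) (lam dlam : R -> M) (f : R -> dual X)
    (ddu ddu' : R -> Y) (N : set R) (CR Cb : R) :
  0 < T -> continuous j -> continuous Aop ->
  0 <= CR -> (forall x y, `|Rop x y| <= CR * `|x| * `|y|) ->
  (forall v a m n, b v (a *: m + n) = a * b v m + b v n) ->
  (forall v m, `|b v m| <= Cb * `|v| * `|m|) ->
  {within `[0, T], continuous u} -> {within `[0, T], continuous f} ->
  in_C1 T lam dlam ->
  (forall v, distributional_ode T (fun t => Rop (j (u t)) (j v) + b v (lam t))
    (fun t => Aop (u t) v) (fun t => f t v)) ->
  in_H2 T (j \o u) ddu ->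
  measurable N -> mu N = 0%E ->
  (forall t, `]0, T[%classic t -> ~ N t -> ddu' t = ddu t) ->
  (forall g : Y -> R, continuous g -> measurable_fun `]0, T[ (g \o ddu')) ->
  mu.-integrable `]0, T[ (EFin \o (fun t => `|ddu' t|)) ->
  forall v s t, 0 <= s -> s <= t -> t <= T ->
  `|Rop (j (u t - u s)) (j v) - (t - s) * (f t v - Aop (u t) v - b v (dlam t))|
    <= (t - s) * (CR * `|j v| * \int[mu]_(x in `]s, t[) `|ddu' x|).
Proof.
move=> T0 cj cA CR0 RC bl bC cu cf lamC1 ode [du [ju_du du_ddu]] mN N0 ddu'E mddu' iddu' v s t s0 st tT.
have [l lE] : exists l : dual Y, forall y, l y = Rop y (j v).
  apply: (@bounded_functional _ _ _ (CR * `|j v|)) => [a x y|x].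
    by rewrite linearP.
  by rewrite mulrAC; exact: RC.
have bCv m : `|b v m| <= Cb * `|v| * `|m| by exact: bC.
have [cPhi wphi] := pairing_weak_derivative T0 cj cA (bl v) bCv lE cu cf lamC1 (ode v).
set Phi := (fun t => f t v - Aop (u t) v - b v (dlam t)) in cPhi wphi *.
have cphi : {within `[0, T], continuous (fun t => l (j (u t)) : R)}.
  apply: (@within_continuous_comp _ _ R^o _ _ (fun x => l (j x)) cu) => x.
  exact: (cvg_comp _ _ (cj x) (@dual_is_continuous _ _ l (j x))).
have [_ duL2 wdu] := ju_du; have [_ _ wddu] := du_ddu.
have [du' [Nd [mNd Nd0 du'E mdu' _]]] := L2_representative duL2.
have mldu' := mdu' _ (@dual_is_continuous _ _ l).
have mlddu' := mddu' _ (@dual_is_continuous _ _ l).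
have w1 : scalar_weak_derivative T (l \o (j \o u)) (l \o du').
  apply: (@weak_derivative_dual _ _ _ (j \o u) (j \o u) du du' set0 Nd l) => //.
  apply/measurable_EFinP; exact: measurable_int (within_continuous_integrable_oo cphi).
have w2 : scalar_weak_derivative T (l \o du') (l \o ddu').
  exact: (@weak_derivative_dual _ _ _ du du' ddu ddu' Nd N l).
(* [Phi] and [l du] are both weak derivatives of [l (j u)], so they have the
   same integral against the derivative of a test function, which is itself
   a test function. *)
have w3 : scalar_weak_derivative T Phi (l \o ddu').
  move=> th tht; have tht1 := test_function_derive1 tht.
  have /oppr_inj -> : - (\int[mu]_(x in `]0, T[) (derive1 th x * Phi x)) =
      - (\int[mu]_(x in `]0, T[) (derive1 th x * (l \o du') x)).
    by rewrite -(wphi _ tht1) -(w1 _ tht1).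
  exact: w2.
have ilddu' := dual_integrable mlddu' iddu'.
have := weak_taylor_le cphi cPhi ilddu' wphi w3 s0 st tT.
rewrite -dualB -linearB lE => /le_trans; apply.
rewrite ler_wpM2l ?subr_ge0//.
have iC : mu.-integrable `]s, t[ (EFin \o (fun x => `|ddu' x|)) by exact: integrable_sub_oo iddu'.
rewrite -RintegralZl//; apply: le_Rintegral => //.
- by apply: integrable_norm; exact: integrable_sub_oo ilddu'.
- exact: (@integrableZl _ _ R mu _ (measurable_itv _) _ _ iC).
by move=> x _; rewrite /= lE mulrAC; exact: RC.
Qed.

(** Duality: for [w] the increment to be bounded, [|w|^2] is the increment of
    [l u] with [l x = <w, x - P x>], hence the integral of [l (du')], and
    [|l x|] is at most [|w| kap] times the distance from [x] to [S]. *)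
Lemma projection_increment (X : normedModType R) (ip : X -> X -> R) (T kap : R)
    (P : X -> X) (S : set X) (u du du' : R -> X) (N : set R) :
  inner_product ip -> 0 <= kap -> S 0 ->
  (forall a x y, P (a *: x + y) = a *: P x + P y) ->
  (forall v, `|v - P v| <= kap * dist_to S v) ->
  {within `[0, T], continuous u} -> weak_derivative T u du ->
  measurable N -> mu N = 0%E ->
  (forall t, `]0, T[%classic t -> ~ N t -> du' t = du t) ->
  (forall g : X -> R, continuous g -> measurable_fun `]0, T[ (g \o du')) ->
  mu.-integrable `]0, T[ (EFin \o (fun t => `|du' t|)) ->
  mu.-integrable `]0, T[ (EFin \o (fun t => dist_to S (du' t))) ->
  forall s t, 0 <= s -> s <= t -> t <= T ->
  `|(u t - P (u t)) - (u s - P (u s))| <= kap * \int[mu]_(x in `]s, t[) dist_to S (du' x).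
Proof.
move=> ipP kap0 S0 Pl Pdist cu wd mN N0 du'E mdu' idu' idist s t s0 st tT.
set w := _ - _ in |- *.
have PB x y : P (x - y) = P x - P y by rewrite addrC -scaleN1r Pl scaleN1r addrC.
have Pw x : `|ip w (x - P x)| <= `|w| * (kap * dist_to S x).
  by rewrite (le_trans (ip_cauchy_schwarz ipP _ _))// ler_wpM2l.
have [l lE] : exists l : dual X, forall x, l x = ip w (x - P x).
  apply: (@bounded_functional _ _ _ (`|w| * kap)) => [a x y|x].
    rewrite Pl (_ : a *: x + y - _ = a *: (x - P x) + (y - P y)); last first.
      by rewrite scalerBr opprD addrACA.
    by rewrite (ipC ipP) (ipPl ipP) !(ipC ipP w).
  rewrite (le_trans (Pw x))// -mulrA ler_wpM2l// ler_wpM2l//.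
  by rewrite -{2}(subr0 x); exact: dist_to_le.
have cphi : {within `[0, T], continuous (fun t => l (u t) : R)}.
  exact: (@within_continuous_comp _ _ R^o _ _ _ cu (@dual_is_continuous _ _ l)).
have mldu' := mdu' _ (@dual_is_continuous _ _ l).
have w1 : scalar_weak_derivative T (l \o u) (l \o du').
  apply: (@weak_derivative_dual _ _ _ u u du du' set0 N l) => //.
  apply/measurable_EFinP; exact: measurable_int (within_continuous_integrable_oo cphi).
have ildu' := dual_integrable mldu' idu'.
have := weak_ftc cphi ildu' w1 s0 st tT.
have -> : l (u t) - l (u s) = `|w| ^+ 2.
  have wE : w = (u t - u s) - (P (u t) - P (u s)).
    by rewrite /w !opprB [X in _ + X = _]addrC addrACA [X in _ + X = _]addrC.
  by rewrite -dualB lE PB -wE (ipxx ipP).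
move=> E.
have [->|w0] := eqVneq w 0.
  by rewrite normr0 mulr_ge0// Rintegral_ge0// => x _; exact: dist_to_ge0.
have nw : 0 < `|w| by rewrite normr_gt0.
rewrite -(ler_pM2l nw) -expr2 E.
have ist : mu.-integrable `]s, t[ (EFin \o (l \o du' : R -> R)) by exact: integrable_sub_oo ildu'.
have ids : mu.-integrable `]s, t[ (EFin \o (fun t => dist_to S (du' t))).
  exact: integrable_sub_oo idist.
apply: (le_trans (ler_norm _)); apply: (le_trans (le_normr_Rintegral _ ist)) => //.
rewrite mulrA -RintegralZl//; apply: le_Rintegral => //.
- exact: integrable_norm ist.
- exact: (@integrableZl _ _ R mu _ (measurable_itv _) (`|w| * kap) _ ids).
by move=> x _; rewrite /= lE -mulrA.
Qed.

End solution_pairings.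

(** * Symmetry by density, finite maxima *)

Section density.
Context {R : realType}.

(** A bounded additive functional vanishing on a dense set is zero; apply this
    in each of the two variables in turn. *)
Lemma symmetric_of_dense (X Y : normedModType R) (j : X -> Y) (Rop : {linear Y -> dual Y}) (C : R) :
  dense (range j) -> (forall x y, `|Rop x y| <= C * `|x| * `|y|) ->
  (forall v w, Rop (j v) (j w) = Rop (j w) (j v)) ->
  forall y z, Rop y z = Rop z y.
Proof.
move=> dj RC sym.
have zero (phi : Y -> R) (K : R) : (forall y z, phi (y - z) = phi y - phi z) ->
    (forall y, `|phi y| <= K * `|y|) -> (forall x, phi (j x) = 0) -> forall y, phi y = 0.
  move=> phiB phiK phij y; apply: contrapT => /eqP py.
  have e0 : 0 < `|phi y| by rewrite normr_gt0.
  have K1 : 0 < `|K| + 1 by rewrite ltr_wpDl.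
  have d0 : 0 < `|phi y| / (`|K| + 1) by rewrite divr_gt0.
  have [y' [yb [x _ jx]]] := dj _ (ex_intro _ y (ballxx y d0 : ball y _ y)) (ball_open y _).
  have {yb jx} : ball y (`|phi y| / (`|K| + 1)) (j x) by rewrite jx.
  rewrite -ball_normE/= ltr_pdivlMr// => yj.
  have : `|phi y| < `|phi y|; last by rewrite ltxx.
  rewrite {1}(_ : phi y = phi (y - j x)); last by rewrite phiB phij subr0.
  apply: le_lt_trans yj; rewrite (le_trans (phiK _))// mulrC ler_wpM2l//.
  by rewrite (le_trans (ler_norm _))// lerDl.
have half x z : Rop z (j x) = Rop (j x) z.
  apply/eqP; rewrite -subr_eq0; apply/eqP.
  apply: (zero (fun z => Rop z (j x) - Rop (j x) z) (2 * (C * `|j x|))) => [y y'|y|x'].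
  - by rewrite linearB dualB -[(Rop y - Rop y') _]/(Rop y (j x) - Rop y' (j x)); ring.
  - rewrite (le_trans (ler_normB _ _))//.
    by have := RC y (j x); have := RC (j x) y; lra.
  - by rewrite sym subrr.
move=> y z; apply/eqP; rewrite -subr_eq0; apply/eqP.
apply: (zero (fun y => Rop y z - Rop z y) (2 * (C * `|z|))) => [x y'|x|x'].
- by rewrite linearB dualB -[(Rop x - Rop y') _]/(Rop x z - Rop y' z); ring.
- rewrite (le_trans (ler_normB _ _))//.
  by have := RC x z; have := RC z x; lra.
- by rewrite half subrr.
Qed.

End density.

Section bigmax.
Context {R : realType}.
Local Open Scope ereal_scope.

Lemma bigmaxe_le (m n : nat) (F : nat -> R) (c : R) :
  (forall i, (m <= i < n)%N -> (F i <= c)%R) ->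
  \big[Order.max/-oo]_(m <= i < n) (F i)%:E <= c%:E.
Proof.
move=> Fc; rewrite big_nat_cond; elim/big_ind : _ => [|x y xc yc|i /andP[mi _]].
- exact: leNye.
- by rewrite ge_max xc yc.
- by rewrite lee_fin Fc.
Qed.

Lemma le_bigmaxe (m n i : nat) (F : nat -> R) : (m <= i < n)%N ->
  (F i)%:E <= \big[Order.max/-oo]_(m <= k < n) (F k)%:E.
Proof.
by move=> mi; apply: le_bigmax_seq => //; rewrite mem_index_iota.
Qed.

(** With nonnegative entries the maximum lies between the first one and the
    sum of all. *)
Lemma bigmaxe_fin (m n : nat) (F : nat -> R) : (m < n)%N -> (forall i, (0 <= F i)%R) ->
  exists c : R, \big[Order.max/-oo]_(m <= i < n) (F i)%:E = c%:E.
Proof.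
move=> mn F0; set B := \big[_/_]_(_ <= _ < _) _.
have B1 : (F m)%:E <= B by apply: le_bigmaxe; rewrite leqnn.
have B2 : B <= (\sum_(m <= i < n) F i)%:E.
  apply: bigmaxe_le => i mi; rewrite (bigD1_seq i) ?iota_uniq ?mem_index_iota//=.
  by rewrite lerDl sumr_ge0.
exists (fine B); rewrite fineK// fin_numE; apply/andP; split.
  by apply/eqP => E; move: B1; rewrite E.
by apply/eqP => E; move: B2; rewrite E.
Qed.

End bigmax.

(** * One step of the scheme *)

Section scheme.
Context {R : realType} {X Y M : normedModType R}.
Context (j : {linear X -> Y}) (Rop : {linear Y -> dual Y}) (Aop : {linear X -> dual X}).
Context (b : X -> M -> R).

Lemma pairing_addl v w z : Rop (j (v + w)) z = Rop (j v) z + Rop (j w) z.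
Proof. by rewrite !linearD. Qed.

Lemma pairing_subl v w z : Rop (j (v - w)) z = Rop (j v) z - Rop (j w) z.
Proof. by rewrite !linearB. Qed.

Lemma pairing_addr y v w : Rop y (j (v + w)) = Rop y (j v) + Rop y (j w).
Proof. by rewrite linearD dualD. Qed.

Lemma pairing_subr y v w : Rop y (j (v - w)) = Rop y (j v) - Rop y (j w).
Proof. by rewrite linearB dualB. Qed.

Context (Rsym : forall v w, Rop (j v) (j w) = Rop (j w) (j v)).
Context (Rpos : forall v, 0 <= Rop (j v) (j v)).

Lemma energy_sub v w : Rop (j (v - w)) (j (v - w)) =
  Rop (j v) (j v) - 2 * Rop (j w) (j v) + Rop (j w) (j w).
Proof. by rewrite pairing_subl !pairing_subr (Rsym v w); ring. Qed.

Lemma energy_polarization v w :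
  2 * Rop (j w) (j v) <= Rop (j v) (j v) + Rop (j w) (j w).
Proof. by have := Rpos (v - w); rewrite energy_sub; lra. Qed.

Lemma energy_add_le v w : Rop (j (v + w)) (j (v + w)) <=
  2 * Rop (j v) (j v) + 2 * Rop (j w) (j w).
Proof.
rewrite pairing_addl !pairing_addr (Rsym v w).
by have := energy_polarization v w; lra.
Qed.

Context (CR CA Cb Cj kap : R).
Context (CR0 : 0 <= CR) (CA0 : 0 <= CA) (Cb0 : 0 <= Cb) (Cj0 : 0 <= Cj) (kap0 : 0 <= kap).
Context (RC : forall x y, `|Rop x y| <= CR * `|x| * `|y|).
Context (AC : forall x y, `|Aop x y| <= CA * `|x| * `|y|).
Context (jC : forall x, `|j x| <= Cj * `|x|).
Context (bC : forall v m, `|b v m| <= Cb * `|v| * `|m|).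
Context (br : forall v a m n, b v (a *: m + n) = a * b v m + b v n).

(** Here [th], [eta], [uh] belong to the time [t_n] and the primed vectors to
    [t_(n-1)], so that [th + (eta + uh)] is the exact solution; [lb] is the
    difference quotient of the discrete multiplier and [dl] the derivative of the exact one.
    Since [th] is annihilated by [Mh], [b th lb] vanishes and [b th dl] equals
    [b th (dl - m)] for every [m] in [Mh].  The remaining terms of the error
    equation are bounded by [|th|] times consistency and projection errors, and
    [energy_step] concludes. *)
Lemma scheme_energy_step (Mh : set M) (al xi dt del rho D B : R)
    (th th' eta eta' uh uh' : X) (f : dual X) (lb dl : M) :
  0 < dt -> 0 < al ->
  al * `|th| ^+ 2 <= Aop th th + xi * Rop (j th) (j th) ->
  Mh 0 -> (forall m, Mh m -> b th m = 0) -> Mh lb ->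
  Rop (j (dt^-1 *: (uh - uh'))) (j th) + b th lb + Aop uh th = f th ->
  `|Rop (j ((th + (eta + uh)) - (th' + (eta' + uh')))) (j th) -
    dt * (f th - Aop (th + (eta + uh)) th - b th dl)| <= dt * (CR * `|j th| * del) ->
  0 <= del ->
  `|eta - eta'| <= kap * rho -> `|eta| <= kap * D ->
  B = CR * Cj * del + Cb * dist_to Mh dl + CR * Cj * Cj * kap * (dt^-1 * rho) +
    CA * kap * D ->
  Rop (j th) (j th) - Rop (j th') (j th') + dt * al * `|th| ^+ 2 <=
  2 * xi * dt * Rop (j th) (j th) + dt * (B ^+ 2 / al).
Proof.
move=> dt0 al0 gh Mh0 Mth Mlb scheme consist del0 etaB etaD BE.
apply: (energy_step (c := Rop (j th') (j th)) dt0 al0 _ _ gh).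
  exact: energy_polarization.
rewrite -pairing_subl.
have jv := jC th.
have bd_le : `|b th dl| <= `|th| * (Cb * dist_to Mh dl).
  rewrite mulrA; apply: le_dist_to => //; first by rewrite mulr_ge0.
  move=> m Mm; have -> : b th dl = b th (dl - m).
    by rewrite addrC -scaleN1r br (Mth m Mm) mulr0 add0r.
  by rewrite (mulrC `|th|); exact: bC.
have A_le : `|Aop eta th| <= `|th| * (CA * kap * D).
  by apply: (le_trans (AC _ _)); rewrite mulrC ler_wpM2l// -mulrA ler_wpM2l.
have R_le : `|Rop (j (eta - eta')) (j th)| <= `|th| * (CR * Cj * Cj * kap * rho).
  apply: (le_trans (RC _ _)).
  have h1 : `|j (eta - eta')| <= Cj * (kap * rho).
    by rewrite (le_trans (jC _))// ler_wpM2l.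
  have -> : `|th| * (CR * Cj * Cj * kap * rho) =
    CR * (Cj * (kap * rho)) * (Cj * `|th|) by ring.
  by rewrite ler_pM ?mulr_ge0// ler_wpM2l.
have incr : (th + (eta + uh)) - (th' + (eta' + uh')) =
    (th - th') + ((eta - eta') + (uh - uh')).
  by rewrite opprD addrACA; congr (_ + _); rewrite opprD addrACA.
have Auh : Aop (th + (eta + uh)) th = Aop th th + Aop eta th + Aop uh th.
  by rewrite addrA !linearD.
move: scheme; rewrite (Mth lb Mlb) addr0 => scheme.
have {}scheme : dt^-1 * Rop (j (uh - uh')) (j th) + Aop uh th = f th.
  by rewrite -scheme !linearZ.
move: consist; rewrite incr Auh (pairing_addl (th - th')) (pairing_addl (eta - eta')).
move: A_le R_le bd_le; rewrite BE -scheme.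
move: (Rop (j (th - th')) _) (Rop (j (eta - eta')) _) (Rop (j (uh - uh')) _) => R1 R2 R3.
move: (Aop th th) (Aop eta th) (Aop uh th) (b th dl) => A1 A2 A3 bd.
move: (dist_to Mh dl) => d A_le R_le bd_le.
set Q := R1 + (R2 + R3) - _ => consist.
have q1 : dt^-1 * Q <= `|th| * (CR * Cj * del).
  rewrite ler_pdivrMl// (le_trans (ler_norm _))// (le_trans consist)// ler_wpM2l ?(ltW dt0)//.
  have -> : `|th| * (CR * Cj * del) = CR * (Cj * `|th|) * del by ring.
  by rewrite ler_wpM2r// ler_wpM2l.
have q2 : - (dt^-1 * R2) <= `|th| * (CR * Cj * Cj * kap * (dt^-1 * rho)).
  rewrite -mulrN.
  have -> : `|th| * (CR * Cj * Cj * kap * (dt^-1 * rho)) =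
    dt^-1 * (`|th| * (CR * Cj * Cj * kap * rho)) by ring.
  by rewrite ler_wpM2l ?invr_ge0 ?(ltW dt0)// (le_trans (ler_norm _))// normrN.
have q3 : - A2 <= `|th| * (CA * kap * D) by rewrite (le_trans (ler_norm _))// normrN.
have q4 : - bd <= `|th| * (Cb * d) by rewrite (le_trans (ler_norm _))// normrN.
(* the error equation: what the scheme leaves for [th] is the consistency
error minus the contributions of [eta] and of the multiplier *)
have -> : dt^-1 * R1 + A1 = dt^-1 * Q - dt^-1 * R2 - A2 - bd.
  by rewrite /Q; field; rewrite gt_eqF.
rewrite !(mulrDr `|th|).
by lra.
Qed.

(** A component [k] in the kernel of a symmetric [Rop] is invisible to the
    energy, which is therefore that of [y]. *)
Lemma initial_energy_le (y k : Y) (v : X) (x D : R) :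
  (forall y z, Rop y z = Rop z y) -> (forall z, Rop k z = 0) ->
  j v = y + k -> 0 <= x -> 0 <= D -> `|y| <= x + Cj * (kap * D) ->
  Rop (j v) (j v) <= (2 * CR + 2 * (CR * Cj ^+ 2 * kap ^+ 2)) * (x ^+ 2 + D ^+ 2).
Proof.
move=> symY Rk jv x0 D0 yle.
have -> : Rop (j v) (j v) = Rop y y.
  have -> : Rop (j v) (j v) = Rop y (y + k) + Rop k (y + k) by rewrite jv linearD.
  by rewrite Rk addr0 dualD (symY y k) Rk addr0.
apply: (le_trans (ler_norm _)); apply: (le_trans (RC _ _)); rewrite -mulrA -expr2.
have y2 : `|y| ^+ 2 <= 2 * x ^+ 2 + 2 * (Cj ^+ 2 * kap ^+ 2 * D ^+ 2).
  apply: (@le_trans _ _ ((x + Cj * (kap * D)) ^+ 2)).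
    by rewrite ler_sqr ?nnegrE// (le_trans _ yle).
  by have := sqr_ge0 (x - Cj * (kap * D)); rewrite -!exprMn mulrA; nra.
apply: (le_trans (ler_wpM2l CR0 y2)).
have h1 : 0 <= CR * D ^+ 2 by rewrite mulr_ge0// sqr_ge0.
have h2 : 0 <= CR * Cj ^+ 2 * kap ^+ 2 * x ^+ 2 by rewrite !mulr_ge0// sqr_ge0.
by lra.
Qed.

End scheme.

(** * The error estimate *)

Theorem theorem4p1 (R : realType) (X Y M : completeNormedModType R)
  (hX : hilbertian X) (hY : hilbertian Y) (hM : reflexive_space M)
  (j : {linear X -> Y}) (j_inj : injective j) (j_cont : continuous j)
  (j_dense : dense (range j))
  (Rop : {linear Y -> dual Y}) (Rop_bounded : continuous Rop)
  (Aop : {linear X -> dual X}) (Aop_bounded : continuous Aop)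
  (b : {bilinear X -> M -> R | *%R & *%R})
  (b_bounded : exists C : R, forall v m, `|b v m| <= C * `|v| * `|m|)
  (V : set X) (V_def : V = annihilated b setT setT)
  (W : set Y) (W_def : W = closure (j @` V))
  (beta : R) (beta_gt0 : 0 < beta) (b_inf_sup : inf_sup b setT setT beta)
  (R_sym_V : forall v w, V v -> V w -> Rop (j v) (j w) = Rop (j w) (j v))
  (R_mono_V : forall v, V v -> 0 <= Rop (j v) (j v))
  (* not in the source, which is false without it: see R_sign_condition *)
  (R_sign : R_sign_condition j Rop)
  (A_sym_V : forall v w, V v -> V w -> Aop v w = Aop w v)
  (gamma alpha : R) (gamma_gt0 : 0 < gamma) (alpha_gt0 : 0 < alpha)
  (garding : forall v, V v ->
     alpha * `|v| ^+ 2 <= Aop v v + gamma * Rop (j v) (j v))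
  (T : R) (T_gt0 : 0 < T)
  (u0 : Y) (u0_W : W u0)
  (g dg : R -> dual M) (g_H1 : in_H1 T g dg)
  (g_cont : {within `[0, T], continuous g})
  (f : R -> dual X) (f_L2 : in_L2 T f)
  (f_cont : {within `[0, T], continuous f})
  (* the continuous solution *)
  (u : R -> X) (lam : R -> M) (u_L2 : in_L2 T u)
  (lam_H1 : exists dl, in_H1 T lam dl)
  (u_lam_sol : continuous_problem j Rop Aop b T f g u0 u lam)
  (* the discretization *)
  (X_ : R -> set X) (M_ : R -> set M)
  (X_fin : forall h, 0 < h -> finite_dim_subspace (X_ h))
  (M_fin : forall h, 0 < h -> finite_dim_subspace (M_ h))
  (xi_ alpha_ beta_ : R -> R)
  (xi_gt0 : forall h, 0 < h -> 0 < xi_ h)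
  (alphah_gt0 : forall h, 0 < h -> 0 < alpha_ h)
  (betah_gt0 : forall h, 0 < h -> 0 < beta_ h)
  (gardingh : forall h, 0 < h -> forall v, annihilated b (X_ h) (M_ h) v ->
     alpha_ h * `|v| ^+ 2 <= Aop v v + xi_ h * Rop (j v) (j v))
  (b_inf_suph : forall h, 0 < h -> inf_sup b (X_ h) (M_ h) (beta_ h))
  (u0h : R -> X) (u0h_X : forall h, 0 < h -> X_ h (u0h h))
  (* the assumptions of the theorem *)
  (dlam : R -> M) (lam_C1 : in_C1 T lam dlam)
  (xi_unif : has_ubound [set xi_ h | h in [set h | 0 < h]])
  (alpha_unif : 0 < inf [set alpha_ h | h in [set h | 0 < h]])
  (beta_unif : 0 < inf [set beta_ h | h in [set h | 0 < h]])
  (du : R -> X) (u_H1 : in_H1 T u du)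
  (u_cont : {within `[0, T], continuous u})
  (ddu : R -> Y) (u_H2 : in_H2 T (j \o u) ddu) :
  exists dt0 C : R, [/\ 0 < dt0, 0 < C &
    forall (h : R) (N : nat) (uh : nat -> X) (lamh : nat -> M),
    0 < h -> (0 < N)%N -> let dt := T / N%:R in dt <= dt0 ->
    discrete_problem j Rop Aop b dt N f g (X_ h) (M_ h) (u0h h) uh lamh ->
    let t n := n%:R * dt in
    let e n := u (t n) - uh n in
    (\big[Order.max/-oo]_(1 <= n < N.+1) (Rop (j (e n)) (j (e n)))%:E
     + (dt * \sum_(1 <= n < N.+1) `|e n| ^+ 2)%:E
     <= C%:E *
       ((`|u0 - j (u0h h)| ^+ 2)%:E
        + \big[Order.max/-oo]_(0 <= n < N.+1) (dist_to (X_ h) (u (t n)) ^+ 2)%:E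
        + \int[lebesgue_measure]_(s in `]0%R, T[)
            (dist_to (X_ h) (du s) ^+ 2)%:E
        + (dt ^+ 2)%:E * L2norm_sq T ddu
        + (dt * \sum_(1 <= n < N.+1) dist_to (M_ h) (dlam (t n)) ^+ 2)%:E))%E].
Proof.
pose mu := @lebesgue_measure R.
have [ip ipP] := hilbertian_inner_product hX.
have [CR CR0 RC] := continuous_linear_dual_bounded Rop_bounded.
have [CA CA0 AC] := continuous_linear_dual_bounded Aop_bounded.
have [Cj Cj0 jC] := continuous_linear_bounded j_cont.
have [Cb0' bC0] := b_bounded; pose Cb := `|Cb0'|.
have Cb0 : 0 <= Cb by exact: normr_ge0.
have bC v m : `|b v m| <= Cb * `|v| * `|m|.
  by rewrite (le_trans (bC0 v m))// ler_wpM2r// ler_wpM2r// ler_norm.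
have bl a x y m : b (a *: x + y) m = a * b x m + b y m by rewrite linearPl.
have br a x m n : b x (a *: m + n) = a * b x m + b x n by rewrite linearPr.
have bBl x y m : b (x - y) m = b x m - b y m.
  by rewrite addrC -scaleN1r bl mulN1r addrC.
have Rsym v w : Rop (j v) (j w) = Rop (j w) (j v) by case: (R_sign v w).
have Rpos v : 0 <= Rop (j v) (j v) by case: (R_sign v v).
have RsymY := symmetric_of_dense j_dense RC Rsym.
set al0 := inf [set alpha_ h | h in [set h | 0 < h]] in alpha_unif.
have al_le h : 0 < h -> al0 <= alpha_ h.
  move=> h0; apply: ge_inf; last by exists h.
  by exists 0 => _ [h' /= h'0 <-]; rewrite ltW// alphah_gt0.
set be0 := inf [set beta_ h | h in [set h | 0 < h]] in beta_unif.
have be_le h : 0 < h -> be0 <= beta_ h.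
  move=> h0; apply: ge_inf; last by exists h.
  by exists 0 => _ [h' /= h'0 <-]; rewrite ltW// betah_gt0.
have [Xi0' XiU] := xi_unif; pose Xi := `|Xi0'|.
have Xi0 : 0 <= Xi by exact: normr_ge0.
have xi_le h : 0 < h -> xi_ h <= Xi.
  by move=> h0; apply: (le_trans _ (ler_norm _)); apply: XiU; exists h.
have [_ duL2 wdu] := u_H1.
have [du' [Nd [mNd Nd0 du'E mdu' du'le]]] := L2_representative duL2.
have [duY [_ [dduL2' dduL2 _]]] := u_H2.
have [ddu' [Ndd [mNdd Ndd0 ddu'E mddu' ddu'le]]] := L2_representative dduL2.
have normX : continuous (fun x : X => `|x|) by exact: norm_continuous.
have normY : continuous (fun x : Y => `|x|) by exact: norm_continuous.
have [iddu iddu2] : mu.-integrable `]0, T[ (EFin \o (fun t => `|ddu' t|)) /\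
    mu.-integrable `]0, T[ (EFin \o (fun t => `|ddu' t| ^+ 2)).
  apply: square_integrable; first exact: mddu' normY.
  by apply: le_lt_trans (ddu'le _ normY) _; case: dduL2.
have [idu idu2] : mu.-integrable `]0, T[ (EFin \o (fun t => `|du' t|)) /\
    mu.-integrable `]0, T[ (EFin \o (fun t => `|du' t| ^+ 2)).
  apply: square_integrable; first exact: mdu' normX.
  by apply: le_lt_trans (du'le _ normX) _; case: duL2.
have [ode bug Ru0 _] := u_lam_sol.
(* The constraint holds almost everywhere, hence by continuity at every
node. *)
have bu_nodes t m : 0 <= t <= T -> b (u t) m = g t m.
  move=> tT; apply/eqP; rewrite -subr_eq0; apply/eqP.
  apply: (@ae_eq_continuous R T (fun t => b (u t) m - g t m)) => //.
    apply: within_continuousB; last first.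
      exact: (@within_continuous_comp _ _ R^o _ _ _ g_cont (@eval_dual_continuous _ _ m)).
    apply: (@within_continuous_comp _ _ R^o _ _ (fun x => b x m) u_cont).
    apply: (@additive_bounded_continuous _ _ R^o _ (Cb * `|m|)) => [x y|x]; first exact: bBl.
    by rewrite mulrAC; exact: bC.
  have [N1 [mN1 N10 bugN]] := bug; exists N1; split => // s /= hs.
  by apply: bugN => /= bs; apply: hs => sT; rewrite bs// subrr.
(* [kap] is the constant of the Fortin projection, [c] collects the weights of
the four errors in one step, [Kc] bounds the energy of [eta] and [cr] that of
[th 0].  [G] and [H] are the Gronwall factors for the energies and for the norms
of [th].  All of them involve the parameters of the discretization only
through their uniform bounds [Xi], [al0] and [be0]. *)
pose kap := 1 + Cb / be0.
have kap0 : 0 <= kap by rewrite addr_ge0// divr_ge0// ltW.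
have kapE : kap = 1 + Cb / be0 by [].
clearbody kap.
pose c := CR * Cj + Cb + CR * Cj * Cj * kap + CA * kap.
have c1 : 0 <= CR * Cj by rewrite mulr_ge0.
have c2 : 0 <= CR * Cj * Cj * kap by rewrite !mulr_ge0.
have c3 : 0 <= CA * kap by rewrite mulr_ge0.
have c0 : 0 <= c by rewrite /c !addr_ge0.
pose Kc := CR * Cj ^+ 2 * kap ^+ 2.
have Kc0 : 0 <= Kc by rewrite /Kc !mulr_ge0// sqr_ge0.
pose cr := 2 * CR + 2 * Kc.
have cr0 : 0 <= cr by rewrite /cr addr_ge0// mulr_ge0.
pose CF := cr + 4 * c ^+ 2 / al0 * (1 + T).
have CF0 : 0 <= CF.
  by rewrite /CF addr_ge0// mulr_ge0 ?addr_ge0 ?(ltW T_gt0)// divr_ge0 ?(ltW alpha_unif)// mulr_ge0// sqr_ge0.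
pose G := expR (4 * Xi * T).
pose H := (1 + 2 * Xi * T * G) / al0.
have G0 : 0 <= G by exact: expR_ge0.
have H0 : 0 <= H.
  by rewrite divr_ge0 ?(ltW alpha_unif)// addr_ge0// !mulr_ge0// ltW.
pose C := 2 * (G * CF) + 2 * Kc + 2 * (H * CF) + 2 * kap ^+ 2 * T + 1.
have Xi1 : 0 < 4 * Xi + 1 by rewrite ltr_wpDl// mulr_ge0.
have C_gt0 : 0 < C.
  have T0 := ltW T_gt0; apply: ltr_wpDl => //.
  have g1 := mulr_ge0 G0 CF0; have g2 := mulr_ge0 H0 CF0; have g3 := mulr_ge0 (sqr_ge0 kap) T0.
  by rewrite -(mulrA 2 (kap ^+ 2)) !addr_ge0// mulr_ge0.
(* any step below this bound satisfies [4 Xi dt <= 1], as Gronwall requires *)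
exists (4 * Xi + 1)^-1, C; split; [by rewrite invr_gt0|exact: C_gt0|].
move=> h N uh lamh h0 N0 dt dtle [uh0 lamh0 disc]; cbv beta zeta.
pose t n := n%:R * dt; pose e n := u (t n) - uh n.
have N0' : 0 < N%:R :> R by rewrite ltr0n.
have dt0 : 0 < dt by rewrite divr_gt0.
have NT : N%:R * dt = T by rewrite /dt mulrCA mulfV ?mulr1// gt_eqF.
have xidt : 4 * Xi * dt <= 1.
  have dtXi : dt * (4 * Xi + 1) <= 1 by rewrite -ler_pdivlMr// mul1r.
  by rewrite mulrC (le_trans _ dtXi)// ler_wpM2l ?(ltW dt0)// lerDl.
have t_ge0 n : 0 <= t n by rewrite mulr_ge0// ltW.
have t_leT n : (n <= N)%N -> t n <= T.
  by move=> nN; rewrite -NT ler_wpM2r ?(ltW dt0)// ler_nat.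
have t_pred n : (1 <= n)%N -> t n - t n.-1 = dt.
  by case: n => // n _; rewrite /t -mulrBl -natrB//= subSnn mul1r.
have t_ltpred n : (1 <= n)%N -> t n.-1 < t n.
  by move=> n1; rewrite -subr_gt0 t_pred.
have infsup0 : inf_sup b (X_ h) (M_ h) be0.
  move=> m Mm; have := b_inf_suph h h0 m Mm; apply: le_trans.
  by rewrite ler_wpM2r// be_le.
have [P [Pl PX Pb Pd]] := fortin_operator ipP bl br bC (X_fin h h0) (M_fin h h0) beta_unif Cb0 infsup0.
rewrite -kapE in Pd.
have [Xh0 XhD] := finite_dim_subspace_closed (X_fin h h0).
have [Mh0 MhD] := finite_dim_subspace_closed (M_fin h h0).
have XhB x y : X_ h x -> X_ h y -> X_ h (x - y).
  by move=> Xx Xy; rewrite addrC -scaleN1r; exact: XhD.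
have Xuh n : (n <= N)%N -> X_ h (uh n).
  case: n => [_|n nN]; first by rewrite uh0; exact: u0h_X.
  by have [] := disc n.+1 nN.
have Mlamh n : (n <= N)%N -> M_ h (lamh n).
  case: n => [_|n nN]; first by rewrite lamh0.
  by have [] := disc n.+1 nN.
pose eta n := u (t n) - P (u (t n)).
pose th n := P (u (t n)) - uh n.
have e_eta n : e n = eta n + th n by rewrite /e /eta /th addrA subrK.
pose D n := dist_to (X_ h) (u (t n)).
have D0 n : 0 <= D n by exact: dist_to_ge0.
have etaD n : `|eta n| <= kap * D n by exact: Pd.
have thV n : (1 <= n <= N)%N -> annihilated b (X_ h) (M_ h) (th n).
  move=> nN; have /andP[n1 nN'] := nN; split; first by apply: XhB => //; exact: Xuh.
  move=> m Mm; have [_ _ _ uhg] := disc n nN.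
  by rewrite bBl Pb// uhg// bu_nodes ?subrr// t_ge0 t_leT.
pose rho s := dist_to (X_ h) (du' s).
have rho0 s : 0 <= rho s by exact: dist_to_ge0.
have cdist : continuous (dist_to (X_ h) : X -> R) by apply: dist_to_continuous; exists 0.
have mrho : measurable_fun `]0, T[ rho by exact: mdu' cdist.
have rhodu s : rho s <= `|du' s| by rewrite -(subr0 (du' s)); exact: dist_to_le.
have [irho irho2] : mu.-integrable `]0, T[ (EFin \o rho) /\
    mu.-integrable `]0, T[ (EFin \o (fun s => rho s ^+ 2)).
  apply: square_integrable => //.
  apply: (@le_lt_trans _ _ (\int[mu]_(s in `]0%R, T[) (`|du' s| ^+ 2)%:E)%E).
    apply: le_lower_integral => s _; first by rewrite lee_fin sqr_ge0.
    by rewrite lee_fin ler_sqr ?nnegrE ?rho0 ?rhodu.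
  by apply: le_lt_trans (du'le _ normX) _; case: duL2.
pose del s := `|ddu' s|.
pose deln n := \int[mu]_(s in `](n.-1)%:R * dt, n%:R * dt[) del s.
pose rhon n := \int[mu]_(s in `](n.-1)%:R * dt, n%:R * dt[) rho s.
pose d n := dist_to (M_ h) (dlam (t n)).
have deln0 n : 0 <= deln n by apply: Rintegral_ge0 => s _; exact: normr_ge0.
have rhon0 n : 0 <= rhon n by apply: Rintegral_ge0 => s _; exact: rho0.
have d0 n : 0 <= d n by exact: dist_to_ge0.
have eta_incr n : (1 <= n <= N)%N -> `|eta n - eta n.-1| <= kap * rhon n.
  move=> /andP[n1 nN].
  exact: (projection_increment ipP kap0 Xh0 Pl Pd u_cont wdu mNd Nd0 du'E mdu' idu irho
    (t_ge0 n.-1) (ltW (t_ltpred n n1)) (t_leT n nN)).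
have cons n v : (1 <= n <= N)%N ->
    `|Rop (j (u (t n) - u (t n.-1))) (j v) -
      dt * (f (t n) v - Aop (u (t n)) v - b v (dlam (t n)))| <=
    dt * (CR * `|j v| * deln n).
  move=> /andP[n1 nN]; rewrite -(t_pred n n1).
  exact: (solution_consistency T_gt0 j_cont Aop_bounded CR0 RC (fun v a m n => br a v m n) bC
    u_cont f_cont lam_C1 ode u_H2 mNdd Ndd0 ddu'E mddu' iddu v
    (t_ge0 n.-1) (ltW (t_ltpred n n1)) (t_leT n nN)).
pose B n := CR * Cj * deln n + Cb * d n + CR * Cj * Cj * kap * (dt^-1 * rhon n) + CA * kap * D n.
have drho0 n : 0 <= dt^-1 * rhon n by rewrite mulr_ge0// invr_ge0 ltW.
have B0 n : 0 <= B n by rewrite /B !addr_ge0// mulr_ge0.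
have Bc n : (1 <= n <= N)%N -> B n <= c * (deln n + d n + dt^-1 * rhon n + D n).
  by move=> _; exact: weighted_sum4_le.
pose r n := Rop (j (th n)) (j (th n)).
have step n : (1 <= n <= N)%N ->
    r n - r n.-1 + dt * al0 * `|th n| ^+ 2 <= 2 * Xi * dt * r n + dt * (B n ^+ 2 / al0).
  move=> nN; have /andP[n1 nN'] := nN; have [Xth Mth] := thV n nN.
  have [_ _ scheme _] := disc n nN.
  have uE k : u (t k) = th k + (eta k + uh k) by rewrite /th /eta addrCA !subrK.
  apply: (scheme_energy_step Rsym Rpos CR0 CA0 Cb0 Cj0 RC AC jC bC (fun v a m n => br a v m n)
    dt0 alpha_unif _ Mh0 Mth _ (scheme _ Xth) _ (deln0 n) (eta_incr n nN) (etaD n) (erefl (B n))).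
  - have gh := gardingh h h0 _ (thV n nN).
    apply: (@le_trans _ _ (alpha_ h * `|th n| ^+ 2)); first by rewrite ler_wpM2r ?sqr_ge0// al_le.
    by apply: (le_trans gh); rewrite lerD2l ler_wpM2r// xi_le.
  - rewrite /backward_diff -[_ *: _]addr0; apply: (MhD) => //.
    rewrite addrC -scaleN1r; apply: MhD => //; apply: Mlamh => //.
    by rewrite (leq_trans (leq_pred n)).
  - by rewrite -!uE; exact: cons.
pose Idel := \int[mu]_(s in `]0, T[) (del s ^+ 2).
pose S1 := \int[mu]_(s in `]0, T[) (rho s ^+ 2).
pose S2 := dt ^+ 2 * Idel.
pose S3 := dt * \sum_(1 <= n < N.+1) d n ^+ 2.
pose S0 := `|u0 - j (u0h h)| ^+ 2.
have S10 : 0 <= S1 by apply: Rintegral_ge0 => s _; exact: sqr_ge0.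
have Idel0 : 0 <= Idel by apply: Rintegral_ge0 => s _; exact: sqr_ge0.
have S20 : 0 <= S2 by rewrite mulr_ge0// sqr_ge0.
have S30 : 0 <= S3 by rewrite mulr_ge0 ?(ltW dt0)// sumr_ge0// => n _; exact: sqr_ge0.
have S00 : 0 <= S0 by exact: sqr_ge0.
have [Sm SmE] := @bigmaxe_fin R 0 N.+1 (fun n => D n ^+ 2) (ltn0Sn N) (fun n => sqr_ge0 _).
have SD n : (n <= N)%N -> D n ^+ 2 <= Sm.
  by move=> nN; rewrite -lee_fin -SmE; apply: (@le_bigmaxe R 0 N.+1 n (fun n => D n ^+ 2)).
have Sm0 : 0 <= Sm by rewrite (le_trans _ (SD 0%N _))// sqr_ge0.
(* Cauchy-Schwarz on each step, summed over the grid *)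
have grid_sq (q : R -> R) : (forall s, 0 <= q s) -> mu.-integrable `]0, T[ (EFin \o q) ->
    mu.-integrable `]0, T[ (EFin \o (fun s => q s ^+ 2)) ->
    \sum_(1 <= n < N.+1) (\int[mu]_(s in `](n.-1)%:R * dt, n%:R * dt[) q s) ^+ 2 <=
    dt * \int[mu]_(s in `]0, T[) (q s ^+ 2).
  move=> q0 iq iq2; rewrite -{1}NT -(@Rintegral_grid R _ dt T N) ?(ltW dt0) ?NT//.
  rewrite mulr_sumr big_nat_cond [leRHS]big_nat_cond; apply: ler_sum => n /andP[nN _].
  have {nN}/andP[n1 nN] : (1 <= n <= N)%N by rewrite -ltnS.
  rewrite -[X in _ <= X * _](t_pred n n1).
  apply: sqr_Rintegral_le; first exact: t_ltpred.
    exact: (integrable_sub_oo (t_ge0 n.-1) (t_leT n nN) iq).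
  exact: (integrable_sub_oo (t_ge0 n.-1) (t_leT n nN) iq2).
have Sdel : dt * \sum_(1 <= n < N.+1) deln n ^+ 2 <= S2.
  by rewrite /S2 expr2 -mulrA ler_wpM2l ?(ltW dt0)//; exact: (grid_sq del (fun s => normr_ge0 _) iddu iddu2).
have Srho : \sum_(1 <= n < N.+1) rhon n ^+ 2 <= dt * S1 by exact: (grid_sq rho rho0 irho irho2).
have r0S : r 0%N <= cr * (S0 + Sm).
  pose k := j (u 0) - u0; pose y := u0 - j (u0h h) - j (eta 0%N).
  have t0 : t 0%N = 0 by rewrite /t mul0r.
  have Rk z : Rop k z = 0.
    have -> : Rop k z = Rop (j (u 0)) z - Rop u0 z by rewrite /k linearB.
    by rewrite Ru0 subrr.
  have jth : j (th 0%N) = y + k.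
    have gid (x w z z' : Y) : x - w = z - w - (z' - x) + (z' - z).
      by rewrite opprB -addrA subrKA addrC subrKA.
    by rewrite /y /k /th /eta t0 uh0 (linearB j) (linearB j) -gid.
  have yle : `|y| <= `|u0 - j (u0h h)| + Cj * (kap * D 0%N).
    apply: (le_trans (ler_normB _ _)); rewrite lerD2l.
    by apply: (le_trans (jC _)); exact: ler_wpM2l.
  rewrite /r; have := initial_energy_le CR0 Cj0 kap0 RC RsymY Rk jth (normr_ge0 _) (D0 0%N) yle.
  move/le_trans; apply.
  by rewrite ler_wpM2l// lerD2l SD.
have [rG aG] := error_bound_of_step dt0 NT alpha_unif Xi0 xidt c0 cr0 S00 Sm0 S10 S20 S30
  (fun n => Rpos (th n)) (fun n => sqr_ge0 `|th n|) B0 Bc step Sdel (lexx S3) Srho SD r0S.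
pose S := S0 + Sm + S1 + S2 + S3.
have S_ge0 : 0 <= S by rewrite !addr_ge0.
have SmS : Sm <= S.
  by rewrite /S -!addrA addrCA lerDl !addr_ge0.
rewrite -/al0 -/CF -/S -/G -/H in rG aG.
have eta2 n : (n <= N)%N -> `|eta n| ^+ 2 <= kap ^+ 2 * Sm.
  move=> nN; apply: (@le_trans _ _ ((kap * D n) ^+ 2)).
    by rewrite ler_sqr ?nnegrE ?mulr_ge0.
  by rewrite exprMn ler_wpM2l ?sqr_ge0// SD.
have LHS1 n : (1 <= n < N.+1)%N -> Rop (j (e n)) (j (e n)) <= (2 * (G * CF) + 2 * Kc) * S.
  rewrite ltnS => /andP[_ nN]; rewrite e_eta.
  apply: (le_trans (energy_add_le Rsym Rpos _ _)); rewrite [leRHS]mulrDl addrC lerD//.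
    by rewrite -(mulrA 2 (G * CF)) -(mulrA G) ler_wpM2l//; exact: rG.
  rewrite -mulrA ler_wpM2l//; apply: (@le_trans _ _ (Kc * Sm)); last by rewrite ler_wpM2l.
  apply: (le_trans (ler_norm _)); apply: (le_trans (RC _ _)).
  have -> : Kc * Sm = CR * (Cj ^+ 2 * (kap ^+ 2 * Sm)) by rewrite /Kc; ring.
  rewrite -mulrA -expr2 ler_wpM2l//.
  apply: (@le_trans _ _ ((Cj * `|eta n|) ^+ 2)).
    by rewrite ler_sqr ?nnegrE ?mulr_ge0.
  by rewrite exprMn ler_wpM2l ?sqr_ge0// eta2.
have LHS2 : dt * \sum_(1 <= n < N.+1) `|e n| ^+ 2 <= (2 * (H * CF) + 2 * kap ^+ 2 * T) * S.
  have h1 : \sum_(1 <= n < N.+1) `|e n| ^+ 2 <=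
      \sum_(1 <= n < N.+1) (2 * `|th n| ^+ 2 + 2 * (kap ^+ 2 * Sm)).
    rewrite big_nat_cond [leRHS]big_nat_cond; apply: ler_sum => n /andP[nN _].
    have {nN}/andP[n1 nN] : (1 <= n <= N)%N by rewrite -ltnS.
    have h2 : `|e n| ^+ 2 <= (`|eta n| + `|th n|) ^+ 2.
      by rewrite ler_sqr ?nnegrE ?addr_ge0// e_eta ler_normD.
    apply: (le_trans h2); have := eta2 n nN; have := sqr_ge0 (`|eta n| - `|th n|).
    by move: `|eta n| `|th n| (kap ^+ 2 * Sm) => x y z; clear; nra.
  apply: (le_trans (ler_wpM2l (ltW dt0) h1)).
  rewrite big_split/= -mulr_sumr sumr_const_nat subn1/= mulrDr.
  have -> : dt * (2 * (kap ^+ 2 * Sm) *+ N) = 2 * kap ^+ 2 * T * Sm.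
    by rewrite -NT -[_ *+ N]mulr_natl; ring.
  have h2 : 2 * kap ^+ 2 * T * Sm <= 2 * kap ^+ 2 * T * S.
    by rewrite ler_wpM2l// !mulr_ge0 ?sqr_ge0// ltW.
  rewrite [leRHS]mulrDl lerD//.
  by rewrite mulrCA -(mulrA 2 (H * CF)) -(mulrA H) ler_wpM2l.
have CS : (2 * (G * CF) + 2 * Kc) * S + (2 * (H * CF) + 2 * kap ^+ 2 * T) * S <= C * S.
  rewrite -mulrDl ler_wpM2r// /C -!addrA !lerD2l lerDl.
  exact: ler01.
have RHS : (S%:E <= (`|u0 - j (u0h h)| ^+ 2)%:E
        + \big[Order.max/-oo]_(0 <= n < N.+1) (dist_to (X_ h) (u (t n)) ^+ 2)%:E
        + \int[lebesgue_measure]_(s in `]0%R, T[)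
            (dist_to (X_ h) (du s) ^+ 2)%:E
        + (dt ^+ 2)%:E * L2norm_sq T ddu
        + (dt * \sum_(1 <= n < N.+1) dist_to (M_ h) (dlam (t n)) ^+ 2)%:E)%E.
  rewrite /S !EFinD; apply: leeD => //; apply: leeD; last first.
    rewrite /S2 EFinM lee_wpmul2l ?lee_fin ?sqr_ge0//.
    rewrite /Idel /Rintegral fineK; last exact: integrable_fin_num iddu2.
    exact: ddu'le normY.
  apply: leeD; last first.
    rewrite /S1 /Rintegral fineK; last exact: integrable_fin_num irho2.
    exact: du'le cdist.
  by apply: leeD => //; rewrite SmE.
apply: (le_trans _ (lee_wpmul2l _ RHS)); last by rewrite lee_fin ltW.
rewrite -EFinM; apply: (@le_trans _ _ (((2 * (G * CF) + 2 * Kc) * S)%:E +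
  ((2 * (H * CF) + 2 * kap ^+ 2 * T) * S)%:E)%E); last by rewrite -EFinD lee_fin.
apply: leeD; last by rewrite lee_fin.
by apply: bigmaxe_le; exact: LHS1.
Qed.
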